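(* For every family $\mathcal{P}$ of probability distributions on a common measurable space, $$1+\chi^2(\mathcal{P})\ \ge\ \sup_{n}\ \sup_{P_1,\dots,P_n\in\mathcal{P}}\ \prod_{i=2}^n\frac{1}{\sqrt{1-\lambda_i(A)^2}},$$ where $A=A(P_1,\dots,P_n)\in\mathbb{R}^{n\times n}$ is the channel overlap matrix of $P_1,\dots,P_n$ and $1=\lambda_1(A)\ge\lambda_2(A)\ge\dots\ge\lambda_n(A)\ge0$ are its eigenvalues. In particular, $$1+\chi^2(\mathcal{P})\ \ge\ \sup_{n}\ \sup_{P_1,\dots,P_n\in\mathcal{P}}\ \frac{1}{\sqrt n}\prod_{i=2}^n\frac{1}{\sqrt{1-A_{ii}^2}}.$$
   Context: For probability measures $P,Q$ on the same space, $\chi^2(P\|Q)=\int \frac{(dP-dQ)^2}{dQ}$ (equal to $+\infty$ if $P\not\ll Q$). Given $P_1,\dots,P_n\in\mathcal{P}$, let $\mathbb{P}_n=\frac{1}{n!}\sum_{\pi\in S_n}\bigotimes_{i=1}^n P_{\pi(i)}$ (permutation mixture) and $\mathbb{Q}_n=\bigl(\frac1n\sum_{i=1}^n P_i\bigr)^{\otimes n}$, and define $\chi^2(\mathcal{P})=\sup_{n\ge1}\sup_{P_1,\dots,P_n\in\mathcal{P}}\chi^2(\mathbb{P}_n\|\mathbb{Q}_n)\in[0,\infty]$. The channel overlap matrix of $P_1,\dots,P_n$ is $A\in\mathbb{R}^{n\times n}$ with $A_{ij}=\frac1n\int\frac{dP_i\,dP_j}{d\overline P}$, $i,j\in[n]$,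 where $\overline P=\frac1n\sum_{i=1}^nP_i$. It is symmetric, doubly stochastic and positive semidefinite. The convention $1/0=+\infty$ is used. *)

(* Defs.v *)
From HB Require Import structures.
From mathcomp Require Import all_boot all_order all_algebra all_fingroup.
From mathcomp Require Import polyrcf.
From mathcomp Require Import all_classical all_reals all_analysis.

Set Implicit Arguments.
Unset Strict Implicit.
Unset Printing Implicit Defensive.

Import Order.TTheory GRing.Theory Num.Theory.
Import numFieldNormedType.Exports.

Local Open Scope classical_set_scope.
Local Open Scope ring_scope.
Local Open Scope charge_scope.
Local Open Scope ereal_scope.

Section mixture.
Context d (T : measurableType d) (R : realType) (I : finType).
(* [i0] only witnesses that the index type is inhabited. *)
Variables (i0 : I) (P : I -> probability T R).

Definition mixture (A : set T) : \bar R :=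
  (#|I|%:R^-1)%:E * \sum_(i : I) P i A.

Let mixture0 : mixture set0 = 0.
Proof. by rewrite /mixture big1 ?mule0// => i _; rewrite measure0. Qed.

Let mixture_ge0 A : 0 <= mixture A.
Proof. by rewrite /mixture mule_ge0 ?lee_fin ?invr_ge0// sume_ge0. Qed.

Let mixture_sigma_additive : semi_sigma_additive mixture.
Proof.
have card_ge0 : (0 <= #|I|%:R^-1 :> R)%R by rewrite invr_ge0.
have -> : mixture = mscale (NngNum card_ge0)
    (msum (fun k => P (nth i0 (enum I) k)) #|I|).
  apply/funext => A; rewrite /mixture /mscale/= /msum; congr (_ * _).
  rewrite (reindex (@enum_val I predT))/=; last first.
    by apply: onW_bij; exact: enum_val_bij.
  by apply: eq_big => // i _; rewrite (enum_val_nth i0).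
exact: measure_semi_sigma_additive.
Qed.

HB.instance Definition _ := isMeasure.Build _ _ _ mixture
  mixture0 mixture_ge0 mixture_sigma_additive.

Let mixture_setT : mixture setT = 1.
Proof.
rewrite /mixture (eq_bigr (cst 1)) => [|i _]; last by rewrite probability_setT.
rewrite /cst sumEFin sumr_const -EFinM mulVf// pnatr_eq0 -lt0n.
by apply/card_gt0P; exists i0.
Qed.

HB.instance Definition _ :=
  Measure_isProbability.Build _ _ _ mixture mixture_setT.

Definition pmixture : probability T R := mixture.

End mixture.

Section product.
Context d (T : measurableType d) (R : realType).

Definition tuple_cons n (xt : T * n.-tuple T) : n.+1.-tuple T :=
  [tuple of xt.1 :: xt.2].

Let measurable_tuple_cons n :
  measurable_fun [set: T * n.-tuple T] (@tuple_cons n).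
Proof. exact: measurable_cons. Qed.

HB.instance Definition _ n :=
  isMeasurableFun.Build _ _ _ _ (@tuple_cons n) (@measurable_tuple_cons n).

(* The product measure P_0 \x ... \x P_(n-1) on n.-tuple T; the recursion is
   justified by product_probE below. *)
Fixpoint product_prob n :
    ('I_n -> probability T R) -> probability (n.-tuple T) R :=
  match n with
  | 0 => fun=> \d_[tuple]
  | m.+1 => fun P => distribution
      (P ord0 \x product_prob (fun i : 'I_m => P (lift ord0 i))) (@tuple_cons m)
  end.

Lemma product_probE n (P : 'I_n -> probability T R) (A : 'I_n -> set T) :
  (forall i, measurable (A i)) ->
  product_prob P [set t | forall i, A i (tnth t i)] = \prod_(i < n) P i (A i).
Proof.
elim: n P A => [|n IH] P A mA.
  by rewrite big_ord0/= diracE mem_set// => -[].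
rewrite big_ord_recl/= /pushforward.
rewrite -IH// -product_measure1E//; last first.
  rewrite [X in measurable X](_ : _ =
      \big[setI/setT]_(i < n) ((@tnth n T ^~ i) @^-1` A (lift ord0 i))).
    apply: bigsetI_measurable => i _; rewrite -[X in measurable X]setTI.
    exact: measurable_tnth.
  apply/seteqP; split => t /=; rewrite -bigcap_seq/= => h i.
    by move=> _; exact: h.
  by apply: h => /=; exact: mem_index_enum.
congr (_ _); apply/seteqP; split => [[x t]/= h|[x t]/= [hx ht] i].
  split; first by have := h ord0.
  by move=> i; have := h (lift ord0 i); rewrite (tnth_nth x)/= -tnth_nth.
have [->//|] := eqVneq i ord0; rewrite eq_sym => /unlift_some[j -> _].
by rewrite (tnth_nth x)/= -tnth_nth.
Qed.

End product.

Section divergence.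
Context d (T : measurableType d) (R : realType).

Definition density (P Q : probability T R) : T -> \bar R :=
  'd (charge_of_finite_measure P) '/d Q.

(* (dP - dQ)^2 / dQ is read as (dP/dQ - 1)^2 dQ. *)
Definition chi2 (P Q : probability T R) : \bar R :=
  if `[< P `<< Q >] then \int[Q]_x (density P Q x - 1) ^+ 2 else +oo.

End divergence.

Section permutation_mixtures.
Context d (T : measurableType d) (R : realType).

(* Dimensions are of the form n.+1, so that indices range over 'I_n.+1 and the
   1-based index i of the usual notation is i - 1 here. *)
Section fixed_dimension.
Variables (n : nat) (P : 'I_n.+1 -> probability T R).

Definition permutation_mixture : probability (n.+1.-tuple T) R :=
  pmixture (1%g : 'S_n.+1) (fun s : 'S_n.+1 => product_prob (fun i => P (s i))).

Definition average : probability T R := pmixture ord0 P.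

Definition iid_average : probability (n.+1.-tuple T) R :=
  product_prob (fun=> average).

(* The integral of dP_i dP_j / dPbar is the integral of the product of the
   densities with respect to Pbar. Nothing is lost by [fine]: the densities are
   bounded by n.+1 almost everywhere. *)
Definition channel_overlap : 'M[R]_n.+1 :=
  \matrix_(i, j) (n.+1%:R^-1 *
    fine (\int[average]_x (density (P i) average x * density (P j) average x)))%R.

End fixed_dimension.

Definition sup_tuples (PP : set (probability T R))
    (F : forall n, ('I_n.+1 -> probability T R) -> \bar R) : \bar R :=
  ereal_sup [set ereal_sup [set F n P | P in
    [set P : 'I_n.+1 -> probability T R | forall i, PP (P i)]] | n in [set: nat]].

(* As a supremum in \bar R, this is -oo if PP is empty. *)
Definition chi2_family (PP : set (probability T R)) : \bar R :=
  sup_tuples PP (fun n P => chi2 (permutation_mixture P) (iid_average P)).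

End permutation_mixtures.

(* The real roots of the characteristic polynomial, repeated according to their
   algebraic multiplicity, in nonincreasing order. *)
Definition eigenvalues (R : realType) n (A : 'M[R]_n) : seq R :=
  sort >=%R (flatten
    [seq nseq (mup x (char_poly A)) x | x <- rootsR (char_poly A)]).

(* Main.v *)
Require Import Defs.
From mathcomp Require Import all_boot all_order all_algebra all_fingroup.
From mathcomp Require Import polyrcf complex spectral zify ring lra.
From mathcomp Require Import all_classical all_reals all_analysis measurable_realfun.

Set Implicit Arguments.
Unset Strict Implicit.
Unset Printing Implicit Defensive.

Import Order.TTheory GRing.Theory Num.Theory.
Import numFieldNormedType.Exports.

Local Open Scope classical_set_scope.
Local Open Scope ring_scope.

(** The idea is to feed the chi-square divergence many copies of the same
    distributions and to let the number of copies tend to infinity.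

    With [h_i] the density of [P_i] with respect to the average, the density of
    the permutation mixture with respect to the product of the averages is
    [1/N! * sum_s prod_k h_(s k) (x_k)]. Integrating its square factor by factor
    gives, for [N] distributions with overlap matrix [B],
    [1 + chi2 = N^N / N!^2 * sum_(s, t) prod_k B_(s k, t k)]
    ([chi2_permutation_mixture]).

    Diagonalize [A = sum_r l_r v_r^T v_r] with [v_0] constant and [l_0 = 1]. If
    each of the [n] distributions is repeated [m] times, the overlap matrix of
    the [N = n m] distributions is the Gram matrix [B_(x, y) = sum_r w_r(x) w_r(y)]
    with [w_r(x) = sqrt(l_r / m) v_r(x mod n)]. Expanding the product of sums turns
    the double sum over permutations into a sum, over words [t] of [N] row indices,
    of the square of the permanent of the rows [w_(t_1), ..., w_(t_N)]. All terms
    are nonnegative, so it is enough to keep the words in which every [r != 0]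
    occurs at most a fixed number of times. The remaining letters are the constant
    row [w_0], which contributes explicit factors; grouping the words by the
    multiplicities [a_r] of the letters [r != 0] leaves the lower bound
    [sum_a J_a^2 / prod_r a_r!], where [J_a] sums the product of the rows of [a] over
    the injective placements of these rows in [N] columns ([sum_perm2_gram_ge]).

    As [m] tends to infinity, [J_a] converges to [prod_r wick l_r a_r], the
    product of the [a_r]! times the coefficients of [t^(a_r)] in
    [exp(- l_r t^2 / 2)] ([injsum_word_cvg]): it is a Wick formula, obtained by
    inclusion-exclusion on the injectivity, in which only the pairings of equal
    letters survive because [v_r] has sum zero and the entries of [w_r] are of
    order [m^(-1/2)]. Since [sum_c (wick l c)^2 / c!] is the power series of
    [1 / sqrt(1 - l^2)], the first bound follows; when some [l_r] with [r != 0] is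
    equal to 1 the series diverges, and the supremum is infinite
    ([prod_inv_sqrt_le]).

    For the second bound, [prod_(r != 0) (1 - l_r^2)] is the determinant of
    [1 - A^2 + J], where [J] is the orthogonal projection on the constants.
    Conjugating by a matrix of determinant one that replaces the first basis
    vector by the all-ones vector and centres the other ones, Hadamard's
    inequality bounds it by [n prod_(i != 0) (1 - (A^2)_(i, i))], and
    [(A^2)_(i, i)] is at least [A_(i, i)^2] ([prod_eigen_le_prod_diag]). *)

(** * Sums over injective placements *)

Section injective_sums.
Context {K : comNzRingType} {X : finType}.
Implicit Types (D : {set X}) (g h : X -> K) (gs : seq (X -> K)).

(** A permanent of a rectangular array, one function per row: distinct rows are
    evaluated at distinct columns. The set [D] of columns already taken is what
    makes a recursion on the list of rows possible. *)
Fixpoint injsum D gs : K :=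
  if gs is g :: gs' then \sum_(x | x \notin D) g x * injsum (x |: D) gs' else 1.

Lemma injsum_cons D g gs :
  injsum D (g :: gs) = \sum_(x | x \notin D) g x * injsum (x |: D) gs.
Proof. by []. Qed.

Lemma injsum_swap D g h gs :
  injsum D [:: g, h & gs] = injsum D [:: h, g & gs].
Proof.
rewrite /=.
under eq_bigr => x _ do rewrite mulr_sumr.
under [RHS]eq_bigr => x _ do rewrite mulr_sumr.
rewrite !pair_big_dep/=.
rewrite (reindex_inj (h := fun p : X * X => (p.2, p.1)))/=; last first.
  by move=> [? ?] [? ?] [-> ->].
apply: eq_big => [[x y]|[x y] _]/=.
  rewrite !in_setU1 !negb_or (eq_sym y).
  by case: (x == y); case: (x \in D); case: (y \in D).
by rewrite finset.setUCA mulrCA.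
Qed.

Lemma injsum_scale D a g gs :
  injsum D ((fun x => a * g x) :: gs) = a * injsum D (g :: gs).
Proof. by rewrite /= mulr_sumr; apply: eq_bigr => x _; rewrite mulrA. Qed.

Lemma eq_injsum_cons D g h gs gs' : g =1 h ->
  (forall D', injsum D' gs = injsum D' gs') ->
  injsum D (g :: gs) = injsum D (h :: gs').
Proof. by move=> gh E /=; apply: eq_bigr => x _; rewrite gh E. Qed.

Lemma injsum_front D g gs1 gs2 :
  injsum D (gs1 ++ g :: gs2) = injsum D (g :: gs1 ++ gs2).
Proof.
elim: gs1 D => [//|h gs1 IH] D; rewrite !cat_cons injsum_swap.
exact: eq_injsum_cons.
Qed.

(** An assignment of columns to rows does not see the order of the rows. *)
Lemma perm_injsum (I : eqType) (w : I -> X -> K) (r s : seq I) D :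
  perm_eq r s -> injsum D (map w r) = injsum D (map w s).
Proof.
elim: r s D => [|i r IH] s D; first by rewrite perm_sym => /perm_nilP ->.
move=> rs; have is_s : i \in s by rewrite -(perm_mem rs) mem_head.
case/splitPr: s / is_s rs => s1 s2 rs.
rewrite map_cat map_cons injsum_front -map_cat.
apply: eq_injsum_cons => // D'; apply: IH.
by move: rs; rewrite perm_sym -cat1s perm_catCA/= perm_cons perm_sym.
Qed.

(** Inclusion-exclusion on the first row: letting it range over all the free
    columns overcounts the placements in which it collides with another row [b],
    and such a collision amounts to a single row carrying the product of the two
    functions. *)
Lemma injsum_rec D (g0 : X -> K) g gs :
  injsum D (g :: gs) = (\sum_(x | x \notin D) g x) * injsum D gs -
    \sum_(b < size gs)
      injsum D ((fun x => nth g0 gs b x * g x) :: take b gs ++ drop b.+1 gs).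
Proof.
elim: gs D g => [|h gs IH] D g.
  by rewrite /= big_ord0 subr0 mulr_suml.
rewrite injsum_swap injsum_cons.
under eq_bigr => x _ do rewrite IH.
rewrite [in RHS]big_ord_recl [X in _ = _ - (X + _)]/= !drop0.
have E x : x \notin D ->
    \sum_(y | y \notin x |: D) g y = \sum_(y | y \notin D) g y - g x.
  move=> xD; rewrite [in RHS](bigD1 x)//= addrAC subrr add0r.
  by apply: eq_bigl => y; rewrite in_setU1 negb_or andbC.
under eq_bigr => x xD do rewrite (E x xD) mulrBr mulrBl mulrBr mulr_sumr.
rewrite sumrB sumrB exchange_big/= opprD addrA; congr (_ - _ - _).
- by rewrite mulr_sumr; apply: eq_bigr => x _; rewrite mulrCA.
- by apply: eq_bigr => x _; rewrite mulrA.
by apply: eq_bigr => b _; exact: (injsum_swap D h _ (take b gs ++ drop b.+1 gs)).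
Qed.

(** A constant row sees only how many columns the other rows leave free. *)
Lemma injsum_const_cons c gs :
  injsum finset.set0 ((fun=> c) :: gs) =
  c * (#|X|%:R - (size gs)%:R) * injsum finset.set0 gs.
Proof.
rewrite (injsum_rec _ (fun=> 0)).
rewrite [X in _ - X](eq_bigr (fun=> c * injsum finset.set0 gs)); last first.
  move=> b _; rewrite -[X in _ = _ * injsum _ X](cat_take_drop b gs).
  rewrite [X in _ = _ * injsum _ (_ ++ X)](drop_nth (fun=> 0))//.
  rewrite injsum_front -injsum_scale; apply: eq_injsum_cons => // x.
  exact: mulrC.
have -> : \sum_(x : X | x \notin finset.set0) c = c *+ #|X|.
  by rewrite -sumr_const; apply: eq_bigl => x; rewrite finset.in_set0.
rewrite sumr_const card_ord -mulr_natr -[in X in _ - X]mulr_natr.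
by ring.
Qed.

Lemma injsum_const_nseq c j gs : (j + size gs <= #|X|)%N ->
  injsum finset.set0 (nseq j (fun=> c) ++ gs) =
  c ^+ j * ((#|X| - size gs) ^_ j)%:R * injsum finset.set0 gs.
Proof.
elim: j => [|j IH] jX; first by rewrite expr0 mul1r mul1r.
rewrite /= -/(injsum finset.set0 ((fun=> c) :: _)) injsum_const_cons IH; last exact: ltnW.
rewrite ffactnSr -subnDA natrM exprS size_cat size_nseq.
rewrite [(size gs + j)%N]addnC natrB; last exact: ltnW.
by ring.
Qed.

Lemma injsum_tuple D n gs : size gs = n ->
  injsum D gs = \sum_(t : n.-tuple X | uniq t && all [pred x | x \notin D] t)
    \prod_(p <- zip gs t) p.1 p.2.
Proof.
elim: gs n D => [|g gs IH] n D.
  move=> /= <-; rewrite (big_pred1 [tuple]) => [|t]; last by rewrite [t]tuple0.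
  by rewrite big_nil.
case: n => [//|n] [szgs]; rewrite injsum_cons.
under eq_bigr => x _ do rewrite (IH _ _ szgs) mulr_sumr.
rewrite pair_big_dep/=.
rewrite [RHS](reindex (fun p : X * n.-tuple X => [tuple of p.1 :: p.2]))/=; last first.
  exists (fun t => (thead t, [tuple of behead t])) => [[x t] _|t _].
    by congr pair; apply: val_inj.
  by rewrite -tuple_eta.
apply: eq_big => [[x t]|[x t] _]/=; last by rewrite big_cons.
rewrite (@eq_all _ _ (predI (predC (pred1 x)) [pred y | y \notin D])) => [|y]; last first.
  by rewrite /= in_setU1 negb_or.
rewrite all_predI all_predC has_pred1; case: (x \in t); rewrite /= ?andbF//.
exact: andbCA.
Qed.

End injective_sums.

(** When there are as many rows as columns, injective placements are
    permutations. *)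
Lemma sum_perm_injsum (K : comNzRingType) N (g : 'I_N -> 'I_N -> K) :
  \sum_(s : 'S_N) \prod_(i < N) g i (s i) =
  injsum finset.set0 [seq g i | i <- enum 'I_N].
Proof.
rewrite (@injsum_tuple _ _ _ N); last by rewrite size_map size_enum_ord.
pose h (s : 'S_N) := [tuple s i | i < N].
pose h' (t : N.-tuple 'I_N) := insubd (1%g : 'S_N) [ffun i => tnth t i].
rewrite [RHS](reindex_onto h h') => [|t /andP[ut _]]; last first.
  apply/eq_from_tnth => i; rewrite tnth_mktuple /h'.
  rewrite [fun_of_perm]unlock val_insubd.
  case: ifP; first by rewrite ffunE.
  by move/negP; case; apply/injectiveP => j k; rewrite !ffunE => /tuple_uniqP-/(_ ut).
apply: eq_big => [s|s _]; last first.
  rewrite /h/= [X in zip _ X](_ : _ = [seq s i | i <- enum 'I_N])//.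
  by rewrite zip_map big_map big_enum.
apply/esym/andP; split; last first.
  apply/eqP/permP => i; rewrite /h' [fun_of_perm]unlock val_insubd; case: ifP => [_|].
    by rewrite ffunE tnth_mktuple [fun_of_perm]unlock.
  move/negP; case; apply/injectiveP => j k; rewrite !ffunE !tnth_mktuple.
  exact: perm_inj.
apply/andP; split; last by apply/allP => x _ /=; rewrite finset.in_set0.
by rewrite /h/= map_inj_uniq ?enum_uniq//; exact: perm_inj.
Qed.

(** * Words with prescribed multiplicities *)

Section words.
Context {I : finType}.
Implicit Types s t : seq I.

Lemma prod_fact_count_cons x s :
  (\prod_i (count_mem i (x :: s))`! =
  (count_mem x s).+1 * \prod_i (count_mem i s)`!)%N.
Proof.
rewrite (bigD1 x)//= [in RHS](bigD1 x)//= eqxx add1n factS -!mulnA; congr (_ * (_ * _))%N.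
by apply: eq_bigr => i; rewrite eq_sym => /negPf ->.
Qed.

(** The multinomial coefficient, in a form without division. Removing the first
    letter [x] of a word divides the product of the factorials of the
    multiplicities by the multiplicity of [x], and these multiplicities add up to
    the length. *)
Lemma card_permutations s :
  (size (permutations s) * \prod_i (count_mem i s)`! = (size s)`!)%N.
Proof.
have [n] := ubnP (size s); elim: n s => // n IH s.
have [-> _|s0 sn] := eqVneq s [::].
  by rewrite big1.
have s_gt0 : (0 < size s)%N by case: (s) s0.
rewrite (perm_size (permutationsE s_gt0)) size_allpairs_dep sumnE big_map big_distrl/=.
transitivity (\sum_(x <- undup s) count_mem x s * (size s).-1`!)%N.
  apply: eq_big_seq => x; rewrite mem_undup => xs.
  have /seq.permP E := perm_to_rem xs.
  rewrite (eq_bigr (fun i => (count_mem i (x :: rem x s))`!)) => [|i _]; last by rewrite -E.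
  rewrite prod_fact_count_cons mulnCA IH ?size_rem//; last by case: (s) s_gt0 sn.
  by rewrite E /= eqxx.
rewrite -big_distrl/= -[in RHS](prednK s_gt0) factS prednK//; congr (_ * _)%N.
rewrite -sum1_size -(big_undup_iterop_count _ s).
by apply: eq_bigr => x _; rewrite Monoid.iteropE iter_addn_0 mul1n.
Qed.

Lemma sum_tuple_perm_eq (V : nmodType) n s (F : seq I -> V) : size s = n ->
  \sum_(t : n.-tuple I | perm_eq t s) F t = \sum_(t <- permutations s) F t.
Proof.
move=> <-.
rewrite -big_filter -(big_map val xpredT).
apply: perm_big; apply: uniq_perm.
- by rewrite map_inj_uniq ?filter_uniq ?index_enum_uniq//; exact: val_inj.
- exact: permutations_uniq.
move=> t; rewrite mem_permutations; apply/mapP/idP => [[u]|ts].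
  by rewrite mem_filter => /andP[us _] ->.
have szt : size t == size s by rewrite (perm_size ts).
by exists (Tuple szt) => //; rewrite mem_filter/= ts mem_index_enum.
Qed.

End words.

(** * Squared permanents of a Gram matrix *)

Section gram.
Context {R : realFieldType} (p N : nat) (w : 'I_p.+1 -> 'I_N -> R).

(** The Cauchy-Binet formula for permanents: distributing the product over the
    sum in [r] chooses a row index [t_i] for every position [i], after which the
    sums over the two permutations separate. *)
Lemma sum_perm2_gram :
  \sum_(s : 'S_N) \sum_(t : 'S_N) \prod_(i < N) \sum_r w r (s i) * w r (t i) =
  \sum_(t : N.-tuple 'I_p.+1) (injsum finset.set0 (map w t)) ^+ 2.
Proof.
under eq_bigr => s _ do (under eq_bigr => t _ do rewrite bigA_distr_bigA/=).
under eq_bigr => s _ do rewrite exchange_big.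
rewrite exchange_big/=.
rewrite (reindex (fun t : N.-tuple 'I_p.+1 => [ffun i => tnth t i]))/=; last first.
  exists (fun f : {ffun 'I_N -> 'I_p.+1} => [tuple f i | i < N]) => [t _|f _].
    by apply: eq_from_tnth => i; rewrite tnth_mktuple ffunE.
  by apply/ffunP => i; rewrite ffunE tnth_mktuple.
apply: eq_bigr => t _.
transitivity ((\sum_(s : 'S_N) \prod_(i < N) w (tnth t i) (s i)) ^+ 2).
  rewrite expr2 big_distrlr/=; apply: eq_bigr => s _; apply: eq_bigr => s' _.
  by rewrite big_split; congr (_ * _); apply: eq_bigr => i _; rewrite ffunE.
rewrite (sum_perm_injsum (fun i => w (tnth t i))); congr (injsum _ _ ^+ 2).
by rewrite map_comp map_tnth_enum.
Qed.

Variables (c : R) (L : nat).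
Hypotheses (w0 : w ord0 = fun=> c) (cN : c ^+ 2 * N%:R = 1) (pLN : (p * L <= N)%N).

Definition word q M (a : {ffun 'I_q -> 'I_M}) : seq 'I_q :=
  flatten [seq nseq (a r) r | r <- enum 'I_q].

Lemma count_word q M (a : {ffun 'I_q -> 'I_M}) r : count_mem r (word a) = a r.
Proof.
rewrite /word count_flatten -map_comp sumnE big_map big_enum/=.
rewrite (bigD1 r)//= count_nseq/= eqxx mul1n big1 ?addn0// => i ir.
by rewrite count_nseq/= (negPf ir).
Qed.

Lemma size_word q M (a : {ffun 'I_q -> 'I_M}) : (size (word a) <= q * M)%N.
Proof.
rewrite /word size_flatten /shape -map_comp sumnE big_map big_enum/=.
have -> : (q * M = \sum_(i < q) M)%N by rewrite sum_nat_const card_ord.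
apply: leq_sum => i _.
by rewrite size_nseq ltnW.
Qed.

(** Among all the words of length [N], only those in which each letter other than
    [ord0] occurs fewer than [L] times are kept. A word with [k] letters other
    than [ord0] contributes through its constant rows [c ^ (N - k) (N - k)!], and
    the number of words of the same type is a multinomial coefficient. The
    constants then combine to [N ^ k / (N (N - 1) ... (N - k + 1)) >= 1]. *)
Lemma sum_perm2_gram_ge :
  \sum_(a : {ffun 'I_p -> 'I_L})
    (injsum finset.set0 [seq w (lift ord0 r) | r <- word a]) ^+ 2
      / \prod_r ((a r)`!%:R)
  <= N%:R ^+ N / N`!%:R ^+ 2 *
     \sum_(s : 'S_N) \sum_(t : 'S_N) \prod_(i < N) \sum_r w r (s i) * w r (t i).
Proof.
rewrite sum_perm2_gram.
pose full (a : {ffun 'I_p -> 'I_L}) :=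
  nseq (N - size (word a)) ord0 ++ [seq lift ord0 r | r <- word a].
have szw (a : {ffun 'I_p -> 'I_L}) : (size (word a) <= N)%N.
  exact: leq_trans (size_word a) pLN.
have szf a : size (full a) = N by rewrite size_cat size_nseq size_map subnK.
have count_full a r : count_mem (lift ord0 r) (full a) = a r.
  rewrite count_cat count_nseq/= add0n count_map -[RHS]count_word.
  by apply: eq_count => i /=; rewrite (inj_eq lift_inj).
have count_full0 a : count_mem ord0 (full a) = (N - size (word a))%N.
  rewrite count_cat count_nseq/= mul1n count_map.
  by rewrite (eq_count (a2 := pred0)) ?count_pred0 ?addn0.
have full_inj a b : perm_eq (full a) (full b) -> a = b.
  move=> /seq.permP ab; apply/ffunP => r; apply: val_inj.
  by rewrite /= -count_full ab count_full.
apply: (@le_trans _ _ (N%:R ^+ N / N`!%:R ^+ 2 *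
    \sum_(a : {ffun 'I_p -> 'I_L}) \sum_(t : N.-tuple 'I_p.+1 | perm_eq t (full a))
       (injsum finset.set0 (map w t)) ^+ 2)); last first.
  apply: ler_wpM2l; first by rewrite divr_ge0// exprn_ge0.
  (* a word has at most one type, so no term is counted twice *)
  rewrite (exchange_big_dep xpredT)//=; apply: ler_sum => t _.
  have [[a ta]|noa] := pselect (exists a, perm_eq t (full a)); last first.
    by rewrite big_pred0 ?sqr_ge0// => a; apply/negP => ta; apply: noa; exists a.
  rewrite (big_pred1 a)// => b /=; apply/idP/eqP => [tb|->//].
  by apply: full_inj; rewrite -(permPl tb).
rewrite mulr_sumr; apply: ler_sum => a _.
set k := size (word a).
set J := injsum _ _.
have -> : \sum_(t : N.-tuple 'I_p.+1 | perm_eq t (full a))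
      injsum finset.set0 (map w t) ^+ 2 =
    (size (permutations (full a)))%:R * (c ^+ (N - k) * (N - k)`!%:R * J) ^+ 2.
  rewrite (sum_tuple_perm_eq (fun t => injsum finset.set0 (map w t) ^+ 2) (szf a)).
  rewrite big_seq (eq_bigr (fun=> (c ^+ (N - k) * (N - k)`!%:R * J) ^+ 2)) => [|t].
    by rewrite -big_seq big_const_seq count_predT iter_addr_0 mulr_natl.
  rewrite mem_permutations => ta.
  rewrite (perm_injsum _ _ ta) map_cat map_nseq w0 -map_comp.
  by rewrite injsum_const_nseq size_map card_ord ?subnK// ffactnn.
have N0 : (N%:R : R) != 0.
  by apply/negP => /eqP N0; move: cN; rewrite N0 mulr0 => /eqP; rewrite eq_sym oner_eq0.
have c2 : c ^+ 2 = N%:R^-1 by apply: (mulIf N0); rewrite cN mulVf.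
have fact0 n : (n`!%:R : R) != 0 by rewrite pnatr_eq0 -lt0n fact_gt0.
have P0 : \prod_r ((a r)`!%:R : R) != 0 by apply/prodf_neq0 => r _.
have E : (size (permutations (full a)))%:R * (N - k)`!%:R * \prod_r ((a r)`!%:R : R) = N`!%:R.
  have := card_permutations (full a); rewrite szf => <-.
  rewrite big_ord_recl count_full0 -/k !natrM mulrA natr_prod.
  by congr (_ * _); apply: eq_bigr => r _; rewrite count_full.
have {E}-> : (size (permutations (full a)))%:R =
    N`!%:R / (N - k)`!%:R / \prod_r ((a r)`!%:R : R).
  by rewrite -E [RHS]mulrAC mulfK// mulfK.
rewrite !exprMn -exprM mulnC exprM c2.
have kN : (k <= N)%N by exact: szw.
rewrite -[in X in N%:R ^+ X](subnK kN) exprD exprVn.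
have -> : N`!%:R = (N ^_ k)%:R * (N - k)`!%:R :> R by rewrite -natrM ffact_fact.
have F0 : ((N ^_ k)%:R : R) != 0 by rewrite pnatr_eq0 -lt0n ffact_gt0.
have -> : N%:R ^+ (N - k) * N%:R ^+ k / ((N ^_ k)%:R * (N - k)`!%:R) ^+ 2 *
  ((N ^_ k)%:R * (N - k)`!%:R / (N - k)`!%:R / (\prod_r (a r)`!%:R) *
   ((N%:R ^+ (N - k))^-1 * (N - k)`!%:R ^+ 2 * J ^+ 2)) =
  (J ^+ 2 / \prod_r (a r)`!%:R) * (N%:R ^+ k / (N ^_ k)%:R).
  by field; rewrite ?fact0 ?F0 ?P0 ?N0 ?expf_neq0.
rewrite ler_peMr ?divr_ge0 ?sqr_ge0 ?prodr_ge0//.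
rewrite ler_pdivlMr ?ltr0n ?ffact_gt0// mul1r -natrX ler_nat.
rewrite ffact_prod -[leqRHS](_ : \prod_(i < k) N = _)%N; last by rewrite prod_nat_const card_ord.
by apply: leq_prod => i _; exact: leq_subr.
Qed.

End gram.

(** * The scaling limit of injective sums *)

(** This is [c]! times the coefficient of [t ^ c] in [exp (- x t ^ 2 / 2)], up to
    sign the [c]-th moment of a centred Gaussian variable of variance [x]. *)
Fixpoint wick {R : pzRingType} (x : R) (c : nat) : R :=
  match c with
  | 0 => 1
  | 1 => 0
  | c'.+2 => - (c'.+1%:R * x * wick x c')
  end.

Lemma wickS (R : pzRingType) (x : R) c :
  wick x c.+1 = - (c%:R * x * wick x c.-1).
Proof. by case: c => //=; rewrite !mul0r oppr0. Qed.

Arguments wick {R} x c : simpl never.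

Section delete.
Context {T : Type}.
Implicit Types (s : seq T).

Definition delete b s := take b s ++ drop b.+1 s.

Lemma size_delete b s : (b < size s)%N -> size (delete b s) = (size s).-1.
Proof.
move=> bs; rewrite size_cat size_drop size_takel ?(ltnW bs)//.
by case: (size s) bs => // n bn; rewrite subSS subnKC.
Qed.

Lemma all_delete a x0 b s : (b < size s)%N ->
  all a s = a (nth x0 s b) && all a (delete b s).
Proof.
move=> bs; rewrite -{1}(cat_take_drop b s) (drop_nth x0)// /delete !all_cat/=.
exact: andbCA.
Qed.

Lemma has_delete a x0 b s : (b < size s)%N ->
  has a s = a (nth x0 s b) || has a (delete b s).
Proof.
move=> bs; rewrite -{1}(cat_take_drop b s) (drop_nth x0)// /delete !has_cat/=.
exact: orbCA.
Qed.

End delete.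

Lemma map_delete T U (f : T -> U) b s : map f (delete b s) = delete b (map f s).
Proof. by rewrite /delete map_cat map_take map_drop. Qed.

Lemma perm_delete (T : eqType) (x0 : T) b s : (b < size s)%N ->
  perm_eq s (nth x0 s b :: delete b s).
Proof.
move=> bs; rewrite -{1}(cat_take_drop b s) (drop_nth x0)// /delete.
by rewrite -cat1s perm_catCA.
Qed.

Lemma eq_cvgn (R : realType) (f g : nat -> R) (a : R) :
  f =1 g -> g m @[m --> \oo] --> a -> f m @[m --> \oo] --> a.
Proof. by move=> /funext ->. Qed.

(** The columns are [m + 1] copies of a fixed finite set [I], and the rows are
    functions on [I] divided by powers of the square root of [m + 1]. A row is
    encoded by a term [(h, d)], which stands for [h / (m + 1) ^ (d / 2)]; the degree [d]
    counts how many original rows have been fused into it. Summed over all the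
    columns, a term of degree 1 gives 0 (its function has sum zero), a term of
    degree 2 gives the sum of its function, and a term of higher degree tends to 0.
    By [injsum_rec] the limits of injective sums are thus computed by fusing rows
    in pairs, which is Wick's formula. *)
Section limit.
Context {R : realType} {I : finType} {X : nat -> finType}.
Variable phi : forall m, X m -> I.
Arguments phi {m}.
Hypothesis fiber : forall m (h : I -> R),
  \sum_(x : X m) h (phi x) = m.+1%:R * \sum_i h i.

Let eps m : R := Num.sqrt (m.+1%:R^-1).
Let term := ((I -> R) * nat)%type.
Let ev m (t : term) (x : X m) : R := t.1 (phi x) * eps m ^+ t.2.
Arguments ev : clear implicits.
Let J m (l : seq term) := injsum finset.set0 (map (ev m) l).
Let fuse (t u : term) : term := (fun i => t.1 i * u.1 i, (t.2 + u.2)%N).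
Let t0 : term := (fun=> 0, 0%N).
Let good (t : term) := (0 < t.2)%N && ((t.2 == 1%N) ==> (\sum_i t.1 i == 0)).
Let slim (t : term) : R := if t.2 == 2 then \sum_i t.1 i else 0.

Let good_fuse t u : good t -> good u -> good (fuse t u).
Proof.
move=> /andP[t0' _] /andP[u0 _]; rewrite /good/= addn_gt0 t0'/=.
by case: t.2 t0' u0 => [//|[|a]] _; case: u.2.
Qed.

Let J_rec m t l : J m (t :: l) = (\sum_(x : X m) ev m t x) * J m l -
  \sum_(b < size l) J m (fuse (nth t0 l b) t :: delete b l).
Proof.
rewrite /J map_cons (injsum_rec _ (ev m t0)) size_map.
congr (_ * _ - _); first by apply: eq_bigl => x; rewrite finset.in_set0.
apply: eq_bigr => b _; rewrite -[_ ++ _]/(delete b _) -map_delete.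
apply: eq_injsum_cons => // x.
by rewrite (nth_map t0)// /ev/= exprD; ring.
Qed.

Let epsX2 m : m.+1%:R * eps m ^+ 2 = 1.
Proof. by rewrite /eps sqr_sqrtr ?mulfV// invr_ge0. Qed.

Let eps_cvg0 : eps m @[m --> \oo] --> (0 : R).
Proof.
rewrite -(sqrtr0 R).
apply: (@cvg_comp _ _ _ (fun m => m.+1%:R^-1) (@Num.sqrt R) _ (nbhs (0 : R))).
  exact: cvg_harmonic.
exact: sqrt_continuous.
Qed.

Let sum_ev_cvg t : good t -> (\sum_(x : X m) ev m t x) @[m --> \oo] --> slim t.
Proof.
move=> /andP[t_gt0 t1].
have E m : \sum_(x : X m) ev m t x = m.+1%:R * eps m ^+ t.2 * \sum_i t.1 i.
  rewrite /= -mulr_suml (fiber _ t.1); ring.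
suff H (d : nat) (S : R) (d_gt0 : (0 < d)%N) (d1 : (d == 1%N) ==> (S == 0)) :
    (m.+1%:R * eps m ^+ d * S) @[m --> \oo] --> (if d == 2 then S else 0).
  by apply: eq_cvgn E _; exact: H.
have [d1E|dN1] := eqVneq d 1%N.
  have /eqP -> : S == 0 by move: d1; rewrite d1E.
  by apply: (eq_cvgn (g := fun=> 0)) => [m|]; rewrite ?mulr0 ?if_same//; exact: cvg_cst.
have [d2E|dN2] := eqVneq d 2%N.
  apply: (eq_cvgn (g := fun=> S)) => [m|]; first by rewrite d2E epsX2 mul1r.
  exact: cvg_cst.
apply: (eq_cvgn (g := fun m => eps m * eps m ^+ (d - 3) * S)) => [m|].
  have -> : d = (2 + (d - 3).+1)%N by lia.
  by rewrite exprD mulrA epsX2 mul1r exprS; congr (_ * _ ^+ _ * _); lia.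
have -> : 0 = 0 * (0 : R) ^+ (d - 3) * S by rewrite !mul0r.
apply: cvgM; last exact: cvg_cst.
apply: cvgM => //; apply: (@continuous_cvg _ _ _ _ _ _ (fun x : R => x ^+ (d - 3))) => //.
exact: exprn_continuous.
Qed.

Let J_cvg_cons t l (a : R) (c : nat -> R) : good t -> J m l @[m --> \oo] --> a ->
  (forall b, (b < size l)%N ->
     J m (fuse (nth t0 l b) t :: delete b l) @[m --> \oo] --> c b) ->
  J m (t :: l) @[m --> \oo] --> slim t * a - \sum_(b < size l) c b.
Proof.
move=> gt Jl Jc; apply: (eq_cvgn (fun m => J_rec m t l)).
apply: cvgB; first by apply: cvgM => //; exact: sum_ev_cvg.
by apply: cvg_big => [|b _]; [exact: add_continuous|exact: Jc].
Qed.

Let good_fuse_delete b t l : (b < size l)%N -> good t -> all good l ->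
  all good (fuse (nth t0 l b) t :: delete b l).
Proof.
by move=> bl gt; rewrite (all_delete _ t0 bl)/= => /andP[gb ->]; rewrite good_fuse.
Qed.

(** The limit exists for every list of terms, by induction on the length; this is
    needed to neglect the products of a bounded factor with one that tends to 0. *)
Let J_cvg l : all good l -> exists a : R, J m l @[m --> \oo] --> a.
Proof.
have [n] := ubnP (size l); elim: n l => // n IH [|t l] szl.
  by move=> _; exists 1; exact: cvg_cst.
move=> /andP[gt gl].
have [a la] := IH l szl gl.
have /choice[c lc] b : exists c : R, (b < size l)%N ->
    J m (fuse (nth t0 l b) t :: delete b l) @[m --> \oo] --> c.
  case: (ltnP b (size l)) => [bl|]; last by exists 0.
  have [|c lc] := IH _ _ (good_fuse_delete bl gt gl); last by exists c.
  by rewrite /= size_delete// prednK ?(leq_ltn_trans _ bl)//.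
by eexists; apply: (J_cvg_cons gt la lc).
Qed.

(** Fusing only increases degrees: once a term has degree at least 3, all the
    descendants of the list by [J_rec] contain such a term, and it must be summed
    at some point. *)
Let J_cvg0 l : all good l -> has (fun t => 2 < t.2)%N l ->
  J m l @[m --> \oo] --> (0 : R).
Proof.
have [n] := ubnP (size l); elim: n l => // n IH [//|t l] szl /andP[gt gl] tl.
have [a la] := J_cvg gl.
have -> : 0 = slim t * (if (2 < t.2)%N then a else 0) - \sum_(b < size l) 0 :> R.
  rewrite big1// subr0; case: ltnP => t2; last by rewrite mulr0.
  by rewrite /slim gtn_eqF// mul0r.
apply: (J_cvg_cons (c := fun=> 0)) => //.
  case: ifP => // /negP/negP tn; apply: IH => //.
  by move: tl; rewrite /= (negPf tn).
move=> b bl; apply: IH; last 1 first.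
- move: tl; rewrite /= (has_delete _ t0 bl) => /orP[|/orP[|->]].
  + by move=> h; rewrite (leq_trans h)// leq_addl.
  + by move=> h; rewrite (leq_trans h)// leq_addr.
  + by rewrite orbT.
- by rewrite /= size_delete// prednK ?(leq_ltn_trans _ bl).
- exact: good_fuse_delete.
Qed.

(** A term of degree 2 factors out in the limit: fusing it with anything gives a
    degree of at least 3. *)
Let J_cvg2 h l (a : R) : all good l -> J m l @[m --> \oo] --> a ->
  J m ((h, 2%N) :: l) @[m --> \oo] --> (\sum_i h i) * a.
Proof.
move=> gl la; rewrite -[X in _ --> X]subr0.
rewrite -[X in _ - X](_ : \sum_(b < size l) 0 = 0); last by rewrite big1.
apply: (J_cvg_cons (c := fun=> 0)) => // b bl; apply: J_cvg0; first exact: good_fuse_delete.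
move: gl; rewrite (all_delete _ t0 bl) => /andP[/andP[g _] _].
by rewrite /= -addn1 -(addnC 2) leq_add2l g.
Qed.

(** The row [r] at the head must be paired with another row, and only the rows of
    the same index [r] contribute, by orthogonality: there are [count_mem r s] of
    them, each contributing [- x r] and leaving a shorter word. This is the
    recursion [wickS]. *)
Lemma injsum_word_cvg (A : finType) (v : A -> I -> R) (x : A -> R) (s : seq A) :
  (forall r, \sum_i v r i = 0) ->
  (forall r q, \sum_i v r i * v q i = if r == q then x r else 0) ->
  injsum finset.set0
    [seq (fun y : X m => v r (phi y) * Num.sqrt (m.+1%:R^-1)) | r <- s]
    @[m --> \oo] --> \prod_r wick (x r) (count_mem r s).
Proof.
move=> v0 vx; pose tm r : term := (v r, 1%N).
have gs s' : all good (map tm s').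
  by rewrite all_map; apply/allP => r _; rewrite /= /good/= v0 eqxx.
suff : J m (map tm s) @[m --> \oo] --> \prod_r wick (x r) (count_mem r s).
  by apply: eq_cvgn => m; rewrite /J -map_comp.
have [n] := ubnP (size s); elim: n s => // n IH [|r s] szs.
  by rewrite big1 => [|r _]; [exact: cvg_cst|rewrite /wick].
pose K := \prod_(q | q != r) wick (x q) (count_mem q s) *
          wick (x r) (count_mem r s).-1.
have -> : \prod_q wick (x q) (count_mem q (r :: s)) =
   slim (tm r) * \prod_q wick (x q) (count_mem q s) -
   \sum_(b < size (map tm s)) (if nth r s b == r then x r * K else 0).
  rewrite mul0r sub0r (bigD1 r)//= eqxx add1n wickS size_map.
  rewrite -big_mkcond/= sumr_const.
  have -> : #|[pred b : 'I_(size s) | nth r s b == r]| = count_mem r s.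
    rewrite -sum1_card -(big_mkord (fun b => nth r s b == r) (fun=> 1%N)).
    by rewrite -(big_nth r (fun i => i == r) (fun=> 1%N)) sum1_count.
  rewrite mulNr; congr (- _); rewrite -mulr_natl /K.
  rewrite (eq_bigr (fun q => wick (x q) (count_mem q s))); first by ring.
  by move=> q; rewrite eq_sym => /negPf ->.
apply: (J_cvg_cons (c := fun b => if nth r s b == r then x r * K else 0)) => [||b].
- by have /andP[] := gs [:: r].
- exact: IH.
rewrite size_map => bs.
have -> : fuse (nth t0 (map tm s) b) (tm r) = (fun i => v (nth r s b) i * v r i, 2%N).
  by rewrite (nth_map r).
rewrite -map_delete.
have -> : (if nth r s b == r then x r * K else 0) =
  (\sum_i v (nth r s b) i * v r i) * \prod_q wick (x q) (count_mem q (delete b s)).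
  rewrite vx; case: eqP => [e|]; last by rewrite mul0r.
  have /seq.permP E := perm_delete r bs.
  have Er : (count_mem r s).-1 = count_mem r (delete b s) by rewrite E /= e eqxx.
  have Eq q : q != r -> count_mem q s = count_mem q (delete b s).
    by rewrite E /= e eq_sym => /negPf ->.
  rewrite e /K Er [in RHS](bigD1 r)//= [X in _ * X]mulrC; congr (_ * (_ * _)).
  by apply: eq_bigr => q /Eq ->.
apply: (J_cvg2 (gs _)); apply: IH; rewrite size_delete//.
by rewrite prednK ?(leq_ltn_trans _ bs)// ltnW.
Qed.

End limit.

(** * The power series of the inverse square root *)

Section wick_series.
Context {R : realFieldType}.

Let a (l : nat) : R := wick 1 l.*2 ^+ 2 / (l.*2)`!%:R.

Let aS l : l.*2.+2%:R * a l.+1 = l.*2.+1%:R * a l.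
Proof.
rewrite /a doubleS wickS succnK !factS !natrM.
have F0 n : (n`!%:R : R) != 0 by rewrite pnatr_eq0 -lt0n fact_gt0.
have N0 n : (n.+1%:R : R) != 0 by rewrite pnatr_eq0.
by field; rewrite F0 nat1r -(natrD _ 2) !N0.
Qed.

Let a_ge0 l : 0 <= a l.
Proof. by rewrite /a divr_ge0 ?sqr_ge0. Qed.

Let a0 : a 0 = 1. Proof. by rewrite /a /wick fact0 expr1n divr1. Qed.

(** The [a k] are the coefficients of [(1 - y) ^ (-1/2)], so their convolution
    square is the constant sequence 1. The proof uses only the recursion [aS]: by
    symmetry [k] times the [k]-th convolution is the sum of [2 i a_i a_(k - i)],
    and [aS] turns it into [k] times the previous convolution. *)
Let conv k : \sum_(i < k.+1) a i * a (k - i) = 1.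
Proof.
elim: k => [|k IH]; first by rewrite big_ord1 subnn a0 mulr1.
have K0 : (k.+1%:R : R) != 0 by rewrite pnatr_eq0.
apply: (mulfI K0); rewrite mulr1.
have sym : \sum_(i < k.+2) (k.+1 - i)%:R * (a i * a (k.+1 - i)) =
           \sum_(i < k.+2) i%:R * (a i * a (k.+1 - i)).
  rewrite (reindex_inj rev_ord_inj)/=; apply: eq_bigr => i _.
  by rewrite subSS subKn ?leq_ord// [X in _ * X]mulrC.
transitivity (\sum_(i < k.+2) (2 * i%:R) * (a i * a (k.+1 - i))).
  under [RHS]eq_bigr => i _ do rewrite -mulrA mulr_natl mulr2n.
  rewrite big_split/= -{1}sym -big_split/= mulr_sumr.
  by apply: eq_bigr => i _; rewrite -mulrDl -natrD subnK ?leq_ord.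
rewrite big_ord_recl mulr0 mul0r add0r.
transitivity (\sum_(i < k.+1) (2 * i%:R + 1) * (a i * a (k - i))).
  apply: eq_bigr => i _; rewrite lift0 subSS.
  have -> : 2 * i%:R + 1 = i.*2.+1%:R :> R by rewrite -mul2n -natrM natr1.
  have -> : 2 * i.+1%:R = i.*2.+2%:R :> R by rewrite -natrM mul2n doubleS.
  by rewrite mulrA aS -mulrA.
have sym' : \sum_(i < k.+1) (k - i)%:R * (a i * a (k - i)) =
           \sum_(i < k.+1) i%:R * (a i * a (k - i)).
  rewrite (reindex_inj rev_ord_inj)/=; apply: eq_bigr => i _.
  by rewrite subSS subKn ?leq_ord// [X in _ * X]mulrC.
under eq_bigr => i _ do rewrite mulrDl mul1r -mulrA mulr_natl mulr2n.
rewrite !big_split/= -{1}sym' -big_split/= IH.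
under eq_bigr => i _ do rewrite -mulrDl -natrD subnK ?leq_ord//.
by rewrite -mulr_sumr IH mulr1 -natr1.
Qed.

Lemma wick_double (x : R) l : wick x l.*2 = x ^+ l * wick 1 l.*2.
Proof.
elim: l => [|l IH]; first by rewrite expr0 mulr1.
by rewrite doubleS !wickS !succnK IH exprS; ring.
Qed.

Lemma wick_doubleS (x : R) l : wick x l.*2.+1 = 0.
Proof. by elim: l => [//|l IH]; rewrite doubleS wickS succnK IH mulr0 oppr0. Qed.

(** Squaring a truncation of the series of [(1 - y) ^ (-1/2)] gives a polynomial
    with nonnegative coefficients whose first ones are those of [1 / (1 - y)].
    Comparing with the geometric series avoids any evaluation of the sum of the
    original series, and covers the divergent case [y = 1] too. *)
Lemma geometric_le_sqr_wick_series (x : R) L :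
  \sum_(k < L) (x ^+ 2) ^+ k <= (\sum_(c < L.*2) wick x c ^+ 2 / c`!%:R) ^+ 2.
Proof.
pose p := \poly_(l < L) a l.
have -> : \sum_(c < L.*2) wick x c ^+ 2 / c`!%:R = p.[x ^+ 2].
  rewrite horner_poly; elim: (L) => [|l IH]; first by rewrite !big_ord0.
  rewrite doubleS !big_ord_recr/= IH wick_doubleS wick_double /a.
  rewrite expr0n mul0r addr0; congr (_ + _).
  by rewrite exprMn -!exprM [(l * 2)%N]mulnC -mulrA mulrC.
rewrite [leRHS]expr2 -hornerM (@horner_coef_wide _ (L + L)); last first.
  rewrite (leq_trans (size_polyMleq _ _))//.
  by rewrite (leq_trans (leq_pred _))// leq_add// size_poly.
have pp k : 0 <= (p * p)`_k.
  rewrite coefM sumr_ge0// => i _; rewrite !coef_poly.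
  by case: ifP; case: ifP; rewrite ?mulr0 ?mul0r// mulr_ge0.
rewrite big_split_ord/=; apply: ler_wpDr.
  by apply: sumr_ge0 => i _; rewrite mulr_ge0// exprn_ge0// sqr_ge0.
apply: ler_sum => k _; rewrite coefM (eq_bigr (fun i : 'I_k.+1 => a i * a (k - i))).
  by rewrite conv mul1r.
move=> i _; rewrite !coef_poly !ifT//; first exact: leq_ltn_trans (leq_subr _ _) _.
exact: leq_trans (ltn_ord i) _.
Qed.

End wick_series.

(** If some [x r] were 1, its geometric partial sums would be unbounded while the
    other factors stay at least 1; so a finite bound [C] forces all [x r < 1]. *)
Lemma prod_inv_sqrt_le (R : realType) (I : finType) (x : I -> R) (C : R) :
  (forall r, 0 <= x r <= 1) ->
  (forall L, \prod_r \sum_(c < L.*2) wick (x r) c ^+ 2 / c`!%:R <= C) ->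
  [/\ 0 <= C, forall r, x r < 1 & \prod_r (Num.sqrt (1 - x r ^+ 2))^-1 <= C].
Proof.
move=> x01 xC.
have wp r L : 0 <= \sum_(c < L.*2) wick (x r) c ^+ 2 / c`!%:R.
  by apply: sumr_ge0 => c _; rewrite divr_ge0 ?sqr_ge0.
have C0 : 0 <= C by apply: le_trans (xC 0%N); apply: prodr_ge0.
have gp r L : 0 <= \sum_(k < L) (x r ^+ 2) ^+ k.
  by apply: sumr_ge0 => k _; rewrite exprn_ge0 ?sqr_ge0.
have geoC L : \prod_r \sum_(k < L) (x r ^+ 2) ^+ k <= C ^+ 2.
  apply: (@le_trans _ _ ((\prod_r \sum_(c < L.*2) wick (x r) c ^+ 2 / c`!%:R) ^+ 2)).
    rewrite -prodrXl; apply: ler_prod => r _.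
    by rewrite gp geometric_le_sqr_wick_series.
  by rewrite lerXn2r// ?nnegrE ?prodr_ge0.
have x1 r : x r < 1.
  rewrite lt_neqAle (andP (x01 r)).2 andbT; apply/eqP => xr.
  have [L CL] : exists L, C ^+ 2 < L.+1%:R.
    exists (Num.truncn (C ^+ 2)).
    by have := truncn_itv (sqr_ge0 C) => /andP[].
  suff : L.+1%:R <= C ^+ 2 by rewrite leNgt CL.
  apply: le_trans (geoC L.+1); rewrite (bigD1 r)//= xr expr1n.
  under eq_bigr => k _ do rewrite expr1n.
  rewrite sumr_const card_ord ler_peMr//.
  apply: (big_ind (fun z => 1 <= z)) => [//|y z|q _]; first exact: mulr_ege1.
  by rewrite big_ord_recl expr0 lerDl sumr_ge0// => k _; rewrite exprn_ge0 ?sqr_ge0.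
split=> //.
have x21 r : 0 < 1 - x r ^+ 2.
  rewrite subr_gt0 exprn_ilt1//; first exact: (andP (x01 r)).1.
rewrite -ler_sqr ?nnegrE ?prodr_ge0//.
rewrite -prodrXl.
under eq_bigr => r _ do rewrite exprVn sqr_sqrtr ?ltW//.
have cv : (\prod_r \sum_(k < L) (x r ^+ 2) ^+ k) @[L --> \oo] --> \prod_r (1 - x r ^+ 2)^-1.
  apply: cvg_big => [|r _]; first exact: mul_continuous.
  have := @cvg_geometric_series R 1 (x r ^+ 2).
  rewrite ger0_norm ?sqr_ge0// => /(_ _).
  rewrite -subr_gt0 mul1r => /(_ (x21 r)); apply: cvg_trans; apply: near_eq_cvg.
  near=> L; rewrite /series/= big_mkord; apply: eq_bigr => k _.
  by rewrite /geometric/= mul1r.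
rewrite -(cvg_lim (@Rhausdorff R) cv); apply: limr_le.
  by apply/cvg_ex; exists (\prod_r (1 - x r ^+ 2)^-1).
by near=> L; exact: geoC.
Unshelve. all: by end_near. Qed.

(** * Orthogonal diagonalization of real symmetric matrices *)

Section symmetric_matrices.
Context {R : rcfType}.

(** A real symmetric matrix is Hermitian over the complex numbers, hence has a
    real eigenvalue there; being a root of the characteristic polynomial does not
    depend on the field. *)
Lemma sym_eigenvalue n (A : 'M[R]_n.+1) : A^T = A -> exists a, eigenvalue A a.
Proof.
move=> Asym; pose f := real_complex R; pose AC := map_mx f A.
have ACH : AC \is hermsymmx.
  apply: realsym_hermsym.
    apply/is_hermitianmxP; rewrite expr0 scale1r map_mx_id//.
    by rewrite /AC -[in LHS]Asym; apply/matrixP => i j; rewrite !mxE.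
  apply/mxOverP => i j; rewrite mxE; apply/complex_realP; by exists (A i j).
pose U := spectralmx AC; pose D := spectral_diag AC.
have /orthomx_spectralP ACE := hermitian_normalmx ACH.
have Ureal := hermitian_spectral_diag_real ACH.
have /complex_realP[a Da] : D 0 0 \is Num.real by have /mxOverP := Ureal; exact.
exists a; rewrite eigenvalue_root_char -(fmorph_root f) map_char_poly.
rewrite -eigenvalue_root_char; apply/eigenvalueP; exists (row 0 U); last first.
  apply/negP => /eqP U0; have := spectral_unit AC; rewrite -/U.
  rewrite -row_free_unit => /row_freeP[W /(congr1 (row 0))].
  rewrite row_mul U0 mul0mx => /rowP/(_ 0); rewrite !mxE eqxx => /esym/eqP.
  by rewrite oner_eq0.
rewrite -/AC ACE -/U -/D !mulmxA -row_mul mulmxV ?spectral_unit//.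
rewrite row1 -rowE row_diag_mx -scalemxAl -rowE; congr (_ *: _).
exact: Da.
Qed.

Lemma dotE n (w : 'rV[R]_n) : (w *m w^T) 0 0 = \sum_i w 0 i ^+ 2.
Proof. by rewrite mxE; apply: eq_bigr => i _; rewrite mxE. Qed.

Lemma dot_ge0 n (w : 'rV[R]_n) : 0 <= (w *m w^T) 0 0.
Proof. by rewrite dotE sumr_ge0// => i _; rewrite sqr_ge0. Qed.

Lemma dot_eq0 n (w : 'rV[R]_n) : ((w *m w^T) 0 0 == 0) = (w == 0).
Proof.
apply/idP/eqP => [|->]; last by rewrite mul0mx mxE.
rewrite dotE psumr_eq0 => [/allP w0|i _]; last exact: sqr_ge0.
apply/rowP => i; have := w0 i (mem_index_enum _).
by rewrite sqrf_eq0 => /eqP ->; rewrite mxE.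
Qed.

(** The reflection that exchanges [u] and the first basis vector, along the
    difference [w] of the two. *)
Lemma householder n (u : 'rV[R]_n.+1) : u *m u^T = 1%:M ->
  exists2 Q : 'M[R]_n.+1, Q *m Q^T = 1%:M & row 0 Q = u.
Proof.
move=> uu; pose e : 'rV[R]_n.+1 := delta_mx 0 0; pose w := e - u.
have [w0|wN0] := eqVneq w 0.
  exists 1%:M; first by rewrite trmx1 mulmx1.
  by rewrite row1; apply/eqP; rewrite -subr_eq0; apply/eqP.
have ee : e *m e^T = 1%:M.
  by rewrite trmx_delta mul_delta_mx; apply/matrixP => i j; rewrite !mxE !ord1.
have ue : u *m e^T = (u 0 0)%:M.
  by rewrite trmx_delta -colE; apply/matrixP => i j; rewrite !mxE !ord1 eqxx.
have eu : e *m u^T = (u 0 0)%:M by rewrite -[e *m _]trmxK trmx_mul trmxK ue tr_scalar_mx.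
have ww : w *m w^T = (2 - 2 * u 0 0)%:M.
  rewrite /w linearB/= mulmxBl !mulmxBr ee ue eu uu.
  by rewrite -!raddfB/=; congr (_%:M); ring.
have s0 : 1 - u 0 0 != 0.
  apply: contra wN0 => /eqP s0; rewrite -dot_eq0 ww.
  have -> : 2 - 2 * u 0 0 = 2 * (1 - u 0 0) by ring.
  by rewrite s0 mulr0 raddf0 mxE.
pose c := (1 - u 0 0)^-1.
pose Q : 'M[R]_n.+1 := 1%:M - c *: (w^T *m w).
have Qsym : Q^T = Q by rewrite /Q linearB/= linearZ/= trmx_mul trmxK trmx1.
have ww2 : (w^T *m w) *m (w^T *m w) = (2 - 2 * u 0 0) *: (w^T *m w).
  by rewrite mulmxA -(mulmxA _ w) ww mul_mx_scalar -scalemxAl.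
exists Q.
  rewrite Qsym /Q; move: (w^T *m w) ww2 => X XX.
  rewrite mulmxBl !mulmxBr !mulmx1 !mul1mx.
  rewrite -scalemxAl -scalemxAr scalerA XX scalerA.
  have -> : c * c * (2 - 2 * u 0 0) = c + c.
    have c1 : c * (1 - u 0 0) = 1 by rewrite mulVf.
    by transitivity (2 * c * (c * (1 - u 0 0))); [ring|rewrite c1; ring].
  by rewrite scalerDl opprB addrK subrK.
rewrite rowE /Q mulmxBr mulmx1 -scalemxAr mulmxA -/e.
have -> : e *m w^T = (1 - u 0 0)%:M.
  by rewrite /w linearB/= mulmxBr ee eu -raddfB.
by rewrite mul_scalar_mx scalerA mulVf// scale1r /w subKr.
Qed.

(** Prescribing the first eigenvector matters when its eigenvalue is multiple: the
    applications need the constant vector to be a member of the eigenbasis. A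
    Householder reflection moves [u] to the first basis vector, which splits off a
    block of size one, and the remaining symmetric block is treated by induction,
    starting from any of its eigenvectors. *)
Lemma spectral_from_eigenvector n (A : 'M[R]_n.+1) (u : 'rV_n.+1) a :
  A^T = A -> u *m u^T = 1%:M -> u *m A = a *: u ->
  exists V : 'M[R]_n.+1, exists d : 'rV[R]_n.+1,
    [/\ V *m V^T = 1%:M, A = V^T *m diag_mx d *m V, row 0 V = u & d 0 0 = a].
Proof.
elim: n A u a => [|n IH] A u a Asym uu uA; have [Q QQ Qu] := householder uu.
  exists Q; exists (const_mx a); split=> //; last by rewrite mxE.
  have AE : A = a%:M.
    apply/matrixP => i j; rewrite !ord1 [RHS]mxE eqxx.
    have u0 : u 0 0 != 0.
      apply/negP => /eqP u0; move/matrixP: uu => /(_ 0 0).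
      by rewrite !mxE big_ord1 u0 mul0r => /esym/eqP; rewrite oner_eq0.
    move/matrixP: uA => /(_ 0 0); rewrite !mxE big_ord1 mulrC => /(mulIf u0).
    by rewrite mulr1n.
  by rewrite diag_const_mx mul_mx_scalar -scalemxAl (mulmx1C QQ) AE scalemx1.
have QQ' : Q^T *m Q = 1%:M := mulmx1C QQ.
pose B : 'M[R]_(1 + n.+1) := Q *m A *m Q^T.
have Bsym : B^T = B by rewrite /B !trmx_mul trmxK Asym mulmxA.
have B0 : row 0 B = a *: delta_mx 0 0.
  rewrite /B !row_mul Qu uA -scalemxAl -Qu -row_mul QQ row1//.
have Bur : ursubmx B = 0.
  apply/rowP => j; move/rowP: B0 => /(_ (rshift 1 j)); rewrite !mxE.
  rewrite (_ : lshift _ 0 = 0); last exact: val_inj.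
  by move=> ->; rewrite mulr0.
have Bul : ulsubmx B = a%:M.
  apply/matrixP => i j; rewrite !ord1; move/rowP: B0 => /(_ 0); rewrite !mxE !eqxx.
  rewrite (_ : lshift _ 0 = 0); last exact: val_inj.
  by move=> ->; rewrite mulr1.
have Bdl : dlsubmx B = 0.
  by rewrite -[dlsubmx B]trmxK trmx_dlsub Bsym Bur trmx0.
pose C := drsubmx B.
have Csym : C^T = C by rewrite /C trmx_drsub Bsym.
have BE : B = block_mx a%:M 0 0 C.
  by rewrite -[LHS]submxK Bul Bur Bdl.
have [b /eigenvalueP[v vC vN0]] := sym_eigenvalue Csym.
pose s := (v *m v^T) 0 0.
have s_gt0 : 0 < s.
  by rewrite lt_def dot_eq0 vN0 dot_ge0.
pose y := (Num.sqrt s)^-1 *: v.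
have yy : y *m (y^T) = 1%:M.
  rewrite /y linearZ/= -scalemxAl -scalemxAr scalerA [v *m _]mx11_scalar -/s.
  rewrite -scalemx1 scalerA -expr2 exprVn sqr_sqrtr ?(ltW s_gt0)// mulVf ?scale1r//.
  by rewrite gt_eqF.
have yC : y *m C = b *: y by rewrite /y -scalemxAl vC !scalerA mulrC.
have [W [d [WW CE _ _]]] := IH C y b Csym yy yC.
pose W1 : 'M[R]_(1 + n.+1) := block_mx 1%:M 0 0 W.
have W1W : W1 *m W1^T = 1%:M.
  rewrite /W1 tr_block_mx !trmx0 trmx1 mulmx_block !mulmx0 !mul0mx !addr0 !add0r.
  by rewrite mulmx1 WW -scalar_mx_block.
exists (W1 *m Q); exists (row_mx a%:M d : 'rV[R]_(1 + n.+1)); split.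
- have -> : W1 *m Q *m (W1 *m Q)^T = W1 *m (Q *m Q^T) *m W1^T.
    by rewrite trmx_mul !mulmxA.
  by rewrite QQ mulmx1.
- have : B = W1^T *m diag_mx (row_mx a%:M d) *m W1.
    rewrite BE {1}CE diag_mx_row /W1 tr_block_mx !trmx0 trmx1 !mulmx_block.
    rewrite !(mulmx0, mul0mx, addr0, add0r, mul1mx, mulmx1); congr block_mx.
    by apply/matrixP => i j; rewrite !ord1 !mxE eqxx.
  move=> /(congr1 (fun M => Q^T *m M *m Q)); rewrite /B !mulmxA QQ' mul1mx.
  by rewrite -mulmxA QQ' mulmx1 => ->; rewrite trmx_mul.
- rewrite row_mul; have -> : row 0 W1 = delta_mx 0 0.
    apply/rowP => j; rewrite !mxE; case: splitP => //= k; rewrite ?ord1 => k0.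
    rewrite !mxE; case: splitP => l; rewrite !mxE => jl.
      by rewrite ord1 eqxx -val_eqE/= jl ord1.
    by rewrite -val_eqE/= jl.
  by rewrite -rowE.
- by rewrite mxE; case: splitP => // k _; rewrite !mxE !ord1 eqxx mulr1n.
Qed.

End symmetric_matrices.

Section orthogonal_diagonalization.
Context {R : rcfType}.

Lemma orthodiag_entry n (V : 'M[R]_n) (d : 'rV_n) i j :
  (V^T *m diag_mx d *m V) i j = \sum_r d 0 r * V r i * V r j.
Proof.
rewrite mxE; apply: eq_bigr => r _; rewrite mul_mx_diag !mxE.
by rewrite [_ * d _ _]mulrC.
Qed.

Lemma char_poly_orthodiag n (V : 'M[R]_n) (d : 'rV_n) : V *m V^T = 1%:M ->
  char_poly (V^T *m diag_mx d *m V) = \prod_i ('X - (d 0 i)%:P).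
Proof.
move=> VV; have VV' := mulmx1C VV.
pose D := diag_mx d.
transitivity (char_poly D); last first.
  rewrite char_poly_trig; last exact: diag_mx_is_trig.
  by apply: eq_bigr => i _; rewrite mxE eqxx mulr1n.
rewrite /char_poly.
have -> : char_poly_mx (V^T *m D *m V) =
    (map_mx polyC V)^T *m char_poly_mx D *m map_mx polyC V.
  rewrite /char_poly_mx !map_mxM mulmxBr mulmxBl -map_trmx; congr (_ - _).
  by rewrite mul_mx_scalar -scalemxAl map_trmx -map_mxM VV' map_mx1 scalemx1.
rewrite !det_mulmx mulrAC -det_mulmx map_trmx -map_mxM VV' map_mx1 det1 mul1r.
by [].
Qed.

Lemma det_orthodiag n (V : 'M[R]_n) (d : 'rV_n) : V *m V^T = 1%:M ->
  \det (V^T *m diag_mx d *m V) = \prod_i d 0 i.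
Proof.
move=> VV; rewrite !det_mulmx mulrAC -det_mulmx (mulmx1C VV) det1 mul1r.
by rewrite det_diag.
Qed.

Lemma dot_row_orthodiag n (V : 'M[R]_n) (d : 'rV_n) r : V *m V^T = 1%:M ->
  (row r V *m (V^T *m diag_mx d *m V) *m (row r V)^T) 0 0 = d 0 r.
Proof.
move=> VV; have rowT (X Y : 'M[R]_n) : (row r X *m (row r Y)^T) 0 0 = (X *m Y^T) r r.
  by rewrite !mxE; apply: eq_bigr => i _; rewrite !mxE.
by rewrite -row_mul rowT !mulmxA VV mul1mx -mulmxA VV mulmx1 mxE eqxx mulr1n.
Qed.

Lemma trace_orthodiag n (V : 'M[R]_n) (d : 'rV_n) : V *m V^T = 1%:M ->
  \tr (V^T *m diag_mx d *m V) = \sum_i d 0 i.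
Proof.
by move=> VV; rewrite mxtrace_mulC mulmxA VV mul1mx mxtrace_diag.
Qed.

Definition psdmx n (A : 'M[R]_n) := forall v : 'rV_n, 0 <= (v *m A *m v^T) 0 0.

Lemma psdmx_diag_ge0 n (A : 'M[R]_n) i : psdmx A -> 0 <= A i i.
Proof.
move=> /(_ (delta_mx 0 i)); rewrite trmx_delta -rowE -colE.
by rewrite !mxE.
Qed.

Lemma psdmx_conj n (A S : 'M[R]_n) : psdmx A -> psdmx (S *m A *m S^T).
Proof. by move=> A0 v; have := A0 (v *m S); rewrite trmx_mul !mulmxA. Qed.

Lemma trmx_conj_sym n (A S : 'M[R]_n) : A^T = A -> (S *m A *m S^T)^T = S *m A *m S^T.
Proof. by move=> Asym; rewrite !trmx_mul trmxK Asym mulmxA. Qed.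

Lemma sym_spectral n (A : 'M[R]_n) : A^T = A ->
  exists V : 'M[R]_n, exists2 d : 'rV[R]_n,
    V *m V^T = 1%:M & A = V^T *m diag_mx d *m V.
Proof.
case: n A => [|n] A Asym.
  by exists 1%:M, 0; [rewrite trmx1 mulmx1|apply/matrixP => -[]].
have [b /eigenvalueP[v vA vN0]] := sym_eigenvalue Asym.
pose s := (v *m v^T) 0 0.
have s_gt0 : 0 < s by rewrite lt_def dot_eq0 vN0 dot_ge0.
have [||V [d [VV AE _ _]]] := @spectral_from_eigenvector _ _ A ((Num.sqrt s)^-1 *: v) b Asym.
- rewrite linearZ/= -scalemxAl -scalemxAr scalerA [v *m _]mx11_scalar -/s.
  rewrite -scalemx1 scalerA -expr2 exprVn sqr_sqrtr ?(ltW s_gt0)// mulVf ?scale1r//.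
  by rewrite gt_eqF.
- by rewrite -scalemxAl vA !scalerA mulrC.
by exists V, d.
Qed.

(** Hadamard's inequality. After scaling rows and columns so that the diagonal
    entries are 1, the determinant is the product of nonnegative eigenvalues whose
    arithmetic mean is 1. *)
Lemma det_psdmx_le n (A : 'M[R]_n) : A^T = A -> psdmx A ->
  \det A <= \prod_i A i i.
Proof.
case: n A => [|n] A Asym A0; first by rewrite det_mx00 big_ord0.
have Aii i := psdmx_diag_ge0 i A0.
have [V [d VV AE]] := sym_spectral Asym.
have d_ge0 r : 0 <= d 0 r by rewrite -(dot_row_orthodiag d r VV) -AE.
have [->|detN0] := eqVneq (\det A) 0; first by apply: prodr_ge0.
have Aii_gt0 i : 0 < A i i.
  rewrite lt_def Aii andbT; apply: contra detN0 => Ai0.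
  apply/det0P; exists (delta_mx 0 i).
    by apply/negP => /eqP/rowP/(_ i); rewrite !mxE !eqxx => /eqP; rewrite oner_eq0.
  rewrite -rowE; apply/rowP => j; rewrite !mxE AE orthodiag_entry big1// => r _.
  move: Ai0; rewrite AE orthodiag_entry psumr_eq0 => [/allP/(_ r)|q _]; last first.
    by rewrite -mulrA mulr_ge0// -expr2 sqr_ge0.
  rewrite mem_index_enum => /(_ isT); rewrite -mulrA -expr2 mulf_eq0 sqrf_eq0.
  by case/orP => /eqP ->; rewrite ?mulr0 ?mul0r.
pose s : 'rV[R]_n.+1 := \row_i (Num.sqrt (A i i))^-1.
pose S := diag_mx s.
have St : S^T = S by rewrite tr_diag_mx.
pose H := S *m A *m S^T.
have Hsym : H^T = H by exact: trmx_conj_sym.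
have Hii i : H i i = 1.
  rewrite /H St mul_mx_diag mxE mul_diag_mx !mxE.
  rewrite mulrAC -expr2 exprVn sqr_sqrtr// mulVf ?gt_eqF//.
have [W [e WW HE]] := sym_spectral Hsym.
have e_ge0 r : 0 <= e 0 r.
  by rewrite -(dot_row_orthodiag e r WW) -HE; apply: psdmx_conj.
have : \det H <= 1.
  rewrite HE det_orthodiag//.
  have := leif_AGM (A := 'I_n.+1) (E := fun i => e 0 i) (fun k _ => e_ge0 k).
  have trH : \tr H = n.+1%:R.
    by rewrite /mxtrace (eq_bigr (fun=> 1)) => [|j _]; rewrite ?sumr_const ?card_ord ?Hii.
  move=> /leifP; rewrite -(trace_orthodiag e WW) -HE trH.
  rewrite card_ord divff ?pnatr_eq0// expr1n.
  by case: ifP => _ => [/eqP ->|/ltW].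
rewrite /H !det_mulmx det_tr -mulrA mulrCA -expr2 det_diag -prodrXl.
rewrite (eq_bigr (fun i => (A i i)^-1)) => [|i _]; last first.
  by rewrite mxE exprVn sqr_sqrtr.
by rewrite prodfV ler_pdivrMr ?mul1r// prodr_gt0.
Qed.

End orthogonal_diagonalization.

(** * Symmetric doubly stochastic matrices *)

Section stochastic.
Context {R : rcfType} {n : nat} {A : 'M[R]_n.+1}.
Hypotheses (Asym : A^T = A) (A_ge0 : forall i j, 0 <= A i j)
  (A_row : forall i, \sum_j A i j = 1) (A_psd : psdmx A).

Let c : R := (Num.sqrt n.+1%:R)^-1.

Let c2 : c ^+ 2 * n.+1%:R = 1.
Proof. by rewrite /c exprVn sqr_sqrtr// mulVf// pnatr_eq0. Qed.

Lemma stochastic_spectral :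
  exists V : 'M[R]_n.+1, exists d : 'rV[R]_n.+1,
    [/\ V *m V^T = 1%:M, A = V^T *m diag_mx d *m V,
        forall j, V 0 j = c, d 0 0 = 1 & forall i, 0 <= d 0 i <= 1].
Proof.
pose u : 'rV[R]_n.+1 := const_mx c.
have [||V [d [VV AE Vu d0]]] := @spectral_from_eigenvector _ _ A u 1 Asym.
- rewrite [LHS]mx11_scalar dotE (eq_bigr (fun=> c ^+ 2)) => [|i _]; last by rewrite mxE.
  by rewrite sumr_const card_ord -mulr_natr c2.
- apply/rowP => j; rewrite scale1r !mxE (eq_bigr (fun i => c * A j i)) => [|i _].
    by rewrite -mulr_sumr A_row mulr1.
  by rewrite mxE -[in LHS]Asym mxE.
exists V, d; split=> //.
  by move=> j; move/rowP: Vu => /(_ j); rewrite !mxE.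
move=> r; pose v := row r V.
have vA : (v *m A *m v^T) 0 0 = d 0 r by rewrite AE dot_row_orthodiag.
rewrite -vA A_psd/= .
have vv : \sum_i v 0 i ^+ 2 = 1.
  rewrite -dotE; have <- : (V *m V^T) r r = 1 by rewrite VV mxE eqxx.
  by rewrite !mxE; apply: eq_bigr => i _; rewrite !mxE.
have -> : (v *m A *m v^T) 0 0 = \sum_i \sum_j A i j * (v 0 i * v 0 j).
  rewrite mxE exchange_big; apply: eq_bigr => j _; rewrite !mxE mulr_suml.
  by apply: eq_bigr => i _; rewrite !mxE; ring.
apply: (@le_trans _ _ (\sum_i \sum_j A i j * (2^-1 * (v 0 i ^+ 2 + v 0 j ^+ 2)))).
  apply: ler_sum => i _; apply: ler_sum => j _; apply: ler_wpM2l => //.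
  have := sqr_ge0 (v 0 i - v 0 j); lra.
rewrite (eq_bigr (fun i =>
  \sum_j (2^-1 * (A i j * v 0 i ^+ 2) + 2^-1 * (A i j * v 0 j ^+ 2)))); last first.
  by move=> i _; apply: eq_bigr => j _; ring.
under eq_bigr => i _ do rewrite big_split/= -!mulr_sumr -mulr_suml A_row mul1r.
rewrite big_split/= -!mulr_sumr vv exchange_big/=.
have A_col j : \sum_i A i j = 1.
  by rewrite -(A_row j); apply: eq_bigr => i _; rewrite -[in LHS]Asym mxE.
under eq_bigr => j _ do rewrite -mulr_suml A_col mul1r.
by rewrite vv; lra.
Qed.

(** The left-hand side is the determinant of [V^T diag(f) V], where [f] is 1 at
    index 0 and [1 - d_r ^ 2] elsewhere. Congruence by [L U], of determinant one,
    turns the basis vector of index 0 into the all-ones vector and subtracts from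
    the other ones their mean; the diagonal entries become [n + 1] at index 0 and
    [1 - (A ^ 2) i i] elsewhere. Hadamard's inequality concludes. *)
Lemma prod_eigen_le_prod_diag (V : 'M[R]_n.+1) (d : 'rV[R]_n.+1) :
  V *m V^T = 1%:M -> A = V^T *m diag_mx d *m V -> (forall j, V 0 j = c) ->
  d 0 0 = 1 -> (forall i, 0 <= d 0 i <= 1) ->
  \prod_(r | r != 0) (1 - d 0 r ^+ 2) <= n.+1%:R * \prod_(i | i != 0) (1 - A i i ^+ 2).
Proof.
move=> VV AE V0 d0 d01; have VV' := mulmx1C VV.
have c0 : c != 0 by rewrite invr_eq0 sqrtr_eq0 -ltNge ltr0n.
pose f : 'rV[R]_n.+1 := \row_r (if r == 0 then 1 else 1 - d 0 r ^+ 2).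
have f_ge0 r : 0 <= f 0 r.
  by rewrite mxE; case: ifP => // _; have /andP[? ?] := d01 r; rewrite subr_ge0 expr_le1.
(* the rows of [L *m U] are the all-ones vector and the centred basis vectors *)
pose L : 'M[R]_n.+1 := \matrix_(i, j) ((i == j)%:R - ((i != 0) && (j == 0))%:R / n.+1%:R).
pose U : 'M[R]_n.+1 := \matrix_(i, j) ((i == j)%:R + ((i == 0) && (j != 0))%:R).
have detL : \det L = 1.
  rewrite det_trig; first by rewrite big1// => i _; rewrite mxE eqxx andNb mul0r subr0.
  apply/is_trig_mxP => i j ij; rewrite mxE -val_eqE/= ltn_eqF//.
  rewrite (_ : (j == 0) = false) ?andbF ?mul0r ?subr0//.
  by rewrite -val_eqE/= gtn_eqF// (leq_ltn_trans _ ij).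
have detU : \det U = 1.
  rewrite -det_tr det_trig; first by rewrite big1// => i _; rewrite !mxE eqxx andbN addr0.
  apply/is_trig_mxP => i j ij; rewrite !mxE -val_eqE/= gtn_eqF//.
  rewrite (_ : (j == 0) = false) ?andFb ?addr0//.
  by rewrite -val_eqE/= gtn_eqF// (leq_ltn_trans _ ij).
pose F := L *m U *m V^T.
have Vsum r : \sum_j V r j = if r == 0 then c^-1 else 0.
  apply: (mulfI c0); rewrite mulr_sumr.
  move/matrixP: VV => /(_ 0 r); rewrite !mxE; under eq_bigr => j _ do rewrite V0 mxE.
  by move=> ->; rewrite eq_sym; case: eqP => _; rewrite ?mulfV// mulr0.
have FE i r : F i r = if i == 0 then \sum_j V r j else V r i - (\sum_j V r j) / n.+1%:R.
  pose Y := U *m V^T.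
  have YE k : Y k r = if k == 0 then \sum_j V r j else V r k.
    rewrite mxE; under eq_bigr => j _ do rewrite !mxE mulrDl.
    rewrite big_split/= (bigD1 k)//= eqxx mul1r big1 ?addr0 => [|j jk]; last first.
      by rewrite eq_sym (negPf jk) mul0r.
    case: eqP => [->|_]; last by rewrite big1 ?addr0// => j _; rewrite mul0r.
    rewrite [RHS](bigD1 0)//= [X in _ + X = _](bigD1 0)//= mul0r add0r; congr (_ + _).
    by apply: eq_bigr => j ->; rewrite mul1r.
  rewrite /F -mulmxA -/Y mxE; under eq_bigr => j _ do rewrite mxE mulrBl.
  rewrite sumrB [X in X - _](bigD1 i)//= eqxx mul1r.
  rewrite [X in _ + X - _]big1 ?addr0 => [|j ji]; last first.
    by rewrite eq_sym (negPf ji) mul0r.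
  rewrite YE; case: eqP => [_|_]; first last.
    rewrite [X in _ - X = _](bigD1 0)//= [X in _ - (_ + X)]big1 ?addr0.
      by rewrite YE eqxx mul1r mulrC.
    by move=> j /negPf ->; rewrite !mul0r.
  by rewrite [X in _ - X]big1 ?subr0// => j _; rewrite !mul0r.
pose G := F *m diag_mx f *m F^T.
have Gpsd : psdmx G.
  apply: psdmx_conj => v; rewrite mxE sumr_ge0// => i _.
  rewrite mul_mx_diag [X in X * _]mxE [v^T _ _]mxE mulrAC mulr_ge0//.
  by rewrite -expr2 sqr_ge0.
have Gsym : G^T = G by apply: trmx_conj_sym; exact: tr_diag_mx.
have detG : \det G = \prod_(r | r != 0) (1 - d 0 r ^+ 2).
  have detF2 : \det F * \det F = 1.
    by rewrite /F !det_mulmx detL detU !mul1r {2}det_tr -det_mulmx VV' det1.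
  rewrite /G det_mulmx det_mulmx det_tr mulrAC detF2 mul1r det_diag.
  rewrite (bigD1 0)//= mxE eqxx mul1r.
  by apply: eq_bigr => r /negPf r0; rewrite mxE r0.
have GE i : G i i = \sum_r f 0 r * F i r ^+ 2.
  rewrite /G mul_mx_diag mxE; apply: eq_bigr => r _; rewrite !mxE; ring.
rewrite -detG; apply: le_trans (det_psdmx_le Gsym Gpsd) _.
rewrite (bigD1 0)//=.
have -> : G 0 0 = n.+1%:R.
  rewrite GE (bigD1 0)//= big1 ?addr0 => [|r /negPf r0]; last first.
    by rewrite FE eqxx Vsum r0 expr0n mulr0.
  rewrite FE !eqxx Vsum eqxx mxE eqxx mul1r exprVn.
  by apply: (mulfI (expf_neq0 2 c0)); rewrite mulfV ?expf_neq0// c2.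
apply: ler_wpM2l => //; apply: ler_prod => i i0.
rewrite psdmx_diag_ge0//= GE.
have -> : \sum_r f 0 r * F i r ^+ 2 = 1 - \sum_r d 0 r ^+ 2 * V r i ^+ 2.
  have <- : \sum_r V r i ^+ 2 = 1.
    have <- : (V^T *m V) i i = 1 by rewrite VV' mxE eqxx.
    by rewrite mxE; apply: eq_bigr => r _; rewrite mxE.
  rewrite -sumrB; apply: eq_bigr => r _; rewrite FE (negPf i0) mxE Vsum.
  case: eqP => [->|_]; last by rewrite mul0r subr0; ring.
  rewrite d0 V0 expr1n mul1r subrr mul1r.
  have -> : c^-1 / n.+1%:R = c.
    apply: (mulfI c0); rewrite mulrA mulfV// mul1r -expr2.
    have N0 : (n.+1%:R : R) != 0 by rewrite pnatr_eq0.
    by apply: (mulIf N0); rewrite mulVf// c2.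
  by rewrite subrr expr0n.
rewrite lerD2l lerN2.
have -> : \sum_r d 0 r ^+ 2 * V r i ^+ 2 = (A *m A) i i.
  rewrite AE; have -> : V^T *m diag_mx d *m V *m (V^T *m diag_mx d *m V) =
    V^T *m diag_mx (\row_r (d 0 r ^+ 2)) *m V.
    rewrite !mulmxA -(mulmxA (V^T *m _)) VV mulmx1; congr (_ *m _).
    by rewrite -mulmxA mulmx_diag.
  by rewrite orthodiag_entry; apply: eq_bigr => r _; rewrite mxE; ring.
rewrite mxE (bigD1 i)//= -expr2 lerDl sumr_ge0// => j _.
by rewrite -{2}Asym mxE -expr2 sqr_ge0.
Qed.

End stochastic.

(** * Sorted sequences of eigenvalues *)

Section eigenvalues.
Context {R : realType}.

Lemma mup_prod_XsubC (x : R) (s : seq R) :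
  mup x (\prod_(a <- s) ('X - a%:P)) = count_mem x s.
Proof.
elim: s => [|a s IH].
  by rewrite big_nil mupNroot// root1.
rewrite big_cons mupM ?polyXsubC_eq0 ?monic_neq0 ?monic_prod_XsubC//.
by rewrite IH -['X - a%:P]expr1 mup_XsubCX/=; case: eqP.
Qed.

Lemma perm_eigenvalues n (A : 'M[R]_n) (s : seq R) :
  char_poly A = \prod_(a <- s) ('X - a%:P) -> perm_eq (eigenvalues A) s.
Proof.
move=> AE; rewrite /eigenvalues perm_sort AE; set p := \prod_(a <- s) _.
have pN0 : p != 0 by rewrite monic_neq0// monic_prod_XsubC.
apply/allP => x _ /=; rewrite count_flatten -map_comp sumnE big_map.
have xs : (x \in rootsR p) = (x \in s).
  have := roots_on_rootsR pN0 x; rewrite in_itv/= => <-.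
  by rewrite root_prod_XsubC.
have us : uniq (rootsR p) by rewrite uniq_roots.
rewrite (eq_bigr (fun y => if y == x then count_mem x s else 0%N)); last first.
  move=> y _; rewrite /= count_nseq/= eq_sym.
  by case: eqP => [->|_]; rewrite ?mul1n ?mul0n// mup_prod_XsubC.
rewrite -big_mkcond/= big_const_seq iter_addn_0 -/(count_mem x _).
rewrite -[count (eq_op^~ x) _]/(count_mem x _) (count_uniq_mem _ us) xs.
by case: (boolP (x \in s)) => [_|/count_memPn ->]; rewrite ?muln1 ?muln0.
Qed.

(** The sequence is sorted in nonincreasing order, so its largest element comes
    first. *)
Lemma eigenvalues_head n (A : 'M[R]_n) (s : seq R) :
  char_poly A = \prod_(a <- 1 :: s) ('X - a%:P) -> (forall a, a \in s -> a <= 1) ->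
  eigenvalues A = 1 :: behead (eigenvalues A) /\ perm_eq (behead (eigenvalues A)) s.
Proof.
move=> /perm_eigenvalues AE s1.
have srt : sorted >=%R (eigenvalues A).
  by apply: sort_sorted => x y; exact: le_total.
have E : eigenvalues A = 1 :: behead (eigenvalues A).
  case: (eigenvalues A) AE srt => [/perm_size//|x l] xl /=.
  rewrite (path_sortedE (rev_trans le_trans)) => /andP[/allP lx _]; congr (_ :: _).
  apply/eqP; rewrite eq_le; apply/andP; split.
    have : x \in 1 :: s by rewrite -(perm_mem xl) mem_head.
    by rewrite in_cons => /orP[/eqP ->//|/s1].
  have : 1 \in x :: l by rewrite (perm_mem xl) mem_head.
  by rewrite in_cons => /orP[/eqP ->//|/lx].
by split=> //; rewrite -(perm_cons 1) -E.
Qed.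

End eigenvalues.

(** * Densities and product measures *)

Local Open Scope ereal_scope.

(** A Radon-Nikodym derivative takes extended real values and is nonnegative only
    almost everywhere, whereas such functions can be added and multiplied pointwise
    as real numbers, and their products integrated by Tonelli's theorem. *)
Definition is_density d (T : measurableType d) (R : realType)
    (P Q : probability T R) (h : T -> R) :=
  [/\ measurable_fun [set: T] h, forall x, (0 <= h x)%R &
      forall A, measurable A -> P A = \int[Q]_(x in A) (h x)%:E].

Section density.
Context d (T : measurableType d) (R : realType).
Implicit Types (P Q : probability T R) (h : T -> R).

Lemma density_dominates P Q h : is_density P Q h -> P `<< Q.
Proof.
move=> [mh h0 PE]; apply/null_content_dominatesP => A mA QA0.
rewrite PE//; apply: null_set_integral => //.
by apply/measurable_EFinP; exact: measurable_funTS.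
Qed.

Lemma density_ae P Q h : is_density P Q h ->
  ae_eq Q [set: T] (density P Q) (EFin \o h).
Proof.
move=> hd; have PQ := density_dominates hd.
apply: integral_ae_eq => //.
- exact: Radon_Nikodym_integrable.
- by case: hd => mh _ _; exact/measurable_EFinP.
move=> E _ mE; rewrite /density -Radon_Nikodym_integral//.
by case: hd => _ _; exact.
Qed.

Lemma density_change_of_variables P Q h (g : T -> \bar R) : is_density P Q h ->
  measurable_fun [set: T] g -> (forall x, 0 <= g x) ->
  \int[P]_x g x = \int[Q]_x (g x * (h x)%:E).
Proof.
move=> hd mg g0; have PQ := density_dominates hd.
rewrite -(Radon_Nikodym_SigmaFinite.change_of_variables PQ g0)//.
have [mh h0 _] := hd.
have mf : measurable_fun [set: T] (Radon_Nikodym_SigmaFinite.f P Q).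
  exact: measurable_int (Radon_Nikodym_SigmaFinite.f_integrable PQ).
apply: ae_eq_integral => //.
- exact: emeasurable_funM.
- by apply: emeasurable_funM => //; exact/measurable_EFinP.
apply: ae_eqe_mul2l; apply: (ae_eq_trans (ae_eq_Radon_Nikodym_SigmaFinite PQ measurableT)).
exact: density_ae.
Qed.

Lemma dominates_is_density P Q : P `<< Q -> exists h, is_density P Q h.
Proof.
move=> PQ; pose f := Radon_Nikodym_SigmaFinite.f P Q.
have fE x : (fine (f x))%:E = f x.
  by rewrite fineK//; exact: Radon_Nikodym_SigmaFinite.f_fin_num.
exists (fine \o f); split.
- have mf : measurable_fun [set: T] f.
    exact: measurable_int (Radon_Nikodym_SigmaFinite.f_integrable PQ).
  exact: measurableT_comp.
- by move=> x /=; apply: fine_ge0; exact: Radon_Nikodym_SigmaFinite.f_ge0.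
move=> A mA; rewrite (Radon_Nikodym_SigmaFinite.f_integral PQ mA).
by apply: eq_integral => x _ /=; rewrite fE.
Qed.

End density.

Section product_integrals.
Context d (T : measurableType d) (R : realType).

Let measurable_tuple_consT n : measurable_fun [set: T * n.-tuple T] (@tuple_cons d T n).
Proof. exact: measurable_funPT. Qed.

Lemma integral_product_probS n (P : 'I_n.+1 -> probability T R)
    (F : n.+1.-tuple T -> \bar R) :
  measurable_fun [set: n.+1.-tuple T] F -> (forall t, 0 <= F t) ->
  \int[product_prob P]_t F t =
  \int[P ord0]_x \int[product_prob (fun i => P (lift ord0 i))]_t
     F (tuple_cons (x, t)).
Proof.
move=> mF F0; rewrite [LHS]ge0_integral_distribution//.
rewrite (@fubini_tonelli1 _ _ _ _ _ _ _ (F \o @tuple_cons d T n))//.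
  exact: measurableT_comp.
by move=> x; exact: F0.
Qed.

Lemma integral_product_prob0 (P : 'I_0 -> probability T R)
    (F : 0.-tuple T -> \bar R) :
  measurable_fun [set: 0.-tuple T] F ->
  \int[product_prob P]_t F t = F [tuple].
Proof. by move=> mF; rewrite [LHS]integral_dirac// diracT mul1e. Qed.

Lemma measurable_prod_tnth n (u : 'I_n -> T -> R) :
  (forall i, measurable_fun [set: T] (u i)) ->
  measurable_fun [set: n.-tuple T] (fun t => \prod_i u i (tnth t i))%R.
Proof.
move=> mu; apply: measurable_prod => i _.
by apply: measurableT_comp => //; exact: measurable_tnth.
Qed.

Lemma prod_tuple_cons n (u : 'I_n.+1 -> T -> R) x (t : n.-tuple T) :
  (\prod_i u i (tnth (tuple_cons (x, t)) i) =
   u ord0 x * \prod_i u (lift ord0 i) (tnth t i))%R.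
Proof.
rewrite big_ord_recl; congr (_ * _)%R; apply: eq_bigr => i _.
by rewrite (tnth_nth x)/= -tnth_nth.
Qed.

Lemma integral_product_prob_prod n (P : 'I_n -> probability T R)
    (u : 'I_n -> T -> R) :
  (forall i, measurable_fun [set: T] (u i)) -> (forall i x, (0 <= u i x)%R) ->
  \int[product_prob P]_t (\prod_i u i (tnth t i))%:E =
  \prod_i \int[P i]_x (u i x)%:E.
Proof.
elim: n P u => [|n IH] P u mu u0.
  rewrite integral_product_prob0 ?big_ord0//.
  by apply/measurable_EFinP; exact: measurable_prod_tnth.
rewrite integral_product_probS; last 2 first.
- by apply/measurable_EFinP; exact: measurable_prod_tnth.
- by move=> t; rewrite lee_fin prodr_ge0.
rewrite big_ord_recl -IH//.
under eq_integral => x _.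
  under eq_integral => t _ do rewrite prod_tuple_cons EFinM.
  rewrite ge0_integralZl//; last 3 first.
  - by apply/measurable_EFinP; exact: (@measurable_prod_tnth n (fun i => u (lift ord0 i))).
  - by move=> t _; rewrite lee_fin prodr_ge0.
  - by rewrite lee_fin.
  over.
rewrite ge0_integralZr//.
- exact/measurable_EFinP.
- by move=> x _; rewrite lee_fin.
by apply: integral_ge0 => t _; rewrite lee_fin prodr_ge0.
Qed.

(** Densities multiply in product measures: the outer integral is rewritten by the
    density of the first factor, the inner one by induction. *)
Lemma integral_product_prob_density n (P : 'I_n -> probability T R)
    (Q : probability T R) (h : 'I_n -> T -> R) (F : n.-tuple T -> \bar R) :
  (forall i, is_density (P i) Q (h i)) ->
  measurable_fun [set: n.-tuple T] F -> (forall t, 0 <= F t) ->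
  \int[product_prob P]_t F t =
  \int[product_prob (fun=> Q)]_t (F t * (\prod_i h i (tnth t i))%:E).
Proof.
elim: n P h F => [|n IH] P h F hd mF F0.
  rewrite !integral_product_prob0 ?big_ord0 ?mule1//.
  apply: emeasurable_funM => //; apply/measurable_EFinP; apply: measurable_prod_tnth.
  by case.
have mh i : measurable_fun [set: T] (h i) by case: (hd i).
have h0 i x : (0 <= h i x)%R by case: (hd i).
have mFc x : measurable_fun [set: n.-tuple T] (fun t => F (tuple_cons (x, t))).
  exact: (measurableT_comp (measurableT_comp mF (@measurable_tuple_consT n)) (pair1_measurable x)).
have mH : measurable_fun [set: n.-tuple T] (fun t => (\prod_i h (lift ord0 i) (tnth t i))%:E).
  by apply/measurable_EFinP; exact: (@measurable_prod_tnth n (fun i => h (lift ord0 i))).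
rewrite integral_product_probS// [RHS]integral_product_probS; last 2 first.
- by apply: emeasurable_funM => //; apply/measurable_EFinP; exact: measurable_prod_tnth.
- by move=> t; rewrite mule_ge0// lee_fin prodr_ge0.
rewrite (density_change_of_variables (hd ord0)); last 2 first.
- apply: (@measurable_fun_fubini_tonelli_F _ _ _ _ _ (product_prob (fun i => P (lift ord0 i)))
    (F \o @tuple_cons d T n)) => [|x]; last exact: F0.
  exact: measurableT_comp.
- by move=> x; by apply: integral_ge0 => t _; exact: F0.
apply: eq_integral => x _.
rewrite (IH _ (fun i => h (lift ord0 i)))//.
rewrite -ge0_integralZr//.
- by apply: eq_integral => t _; rewrite prod_tuple_cons -muleA [X in _ * X]muleC EFinM.
- exact: emeasurable_funM.
- by move=> t _; rewrite mule_ge0// lee_fin prodr_ge0.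
- by rewrite lee_fin.
Qed.

End product_integrals.

(** * The chi-square divergence of a permutation mixture *)

Lemma integral_pmixture d (T : measurableType d) (R : realType) (I : finType)
    (i0 : I) (P : I -> probability T R) (g : T -> \bar R) :
  measurable_fun [set: T] g -> (forall x, 0 <= g x) ->
  \int[pmixture i0 P]_x g x = (#|I|%:R^-1)%:E * \sum_i \int[P i]_x g x.
Proof.
move=> mg g0.
have card_ge0 : (0 <= #|I|%:R^-1 :> R)%R by rewrite invr_ge0.
rewrite (eq_measure_integral (mscale (NngNum card_ge0)
    (msum (fun k => P (nth i0 (enum I) k)) #|I|))); last first.
  move=> A mA _; rewrite /pmixture/= /mixture /mscale/= /msum; congr (_ * _).
  rewrite (reindex (@enum_val I predT))/=; last first.
    by apply: onW_bij; exact: enum_val_bij.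
  by apply: eq_big => // i _; rewrite (enum_val_nth i0).
rewrite ge0_integral_mscale//= ge0_integral_measure_sum//; congr (_ * _).
rewrite [RHS](reindex (@enum_val I predT))/=; last first.
  by apply: onW_bij; exact: enum_val_bij.
by apply: eq_big => // i _; rewrite (enum_val_nth i0).
Qed.

(** From [(h - 1) ^ 2 + 2 h = h ^ 2 + 1], where all the terms are nonnegative and
    can be integrated separately even if [h ^ 2] is not integrable. *)
Lemma chi2_density d (T : measurableType d) (R : realType)
    (P Q : probability T R) (h : T -> R) : is_density P Q h ->
  1 + chi2 P Q = \int[Q]_x (h x ^+ 2)%:E.
Proof.
move=> hd; have PQ := density_dominates hd; have [mh h0 PE] := hd.
rewrite /chi2 asboolT//.
have -> : \int[Q]_x (density P Q x - 1) ^+ 2 = \int[Q]_x ((h x - 1) ^+ 2)%:E.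
  have mdens : measurable_fun [set: T] (density P Q).
    by apply: (@measurable_int _ _ _ Q); exact: Radon_Nikodym_integrable.
  apply: ae_eq_integral => //.
  - have m1 : measurable_fun [set: T] (fun x => density P Q x - 1).
      by apply: emeasurable_funB => //; exact: measurable_cst.
    exact: (emeasurable_funM m1 m1).
  - apply/measurable_EFinP; apply: measurable_funX; exact: measurable_funB.
  apply: filterS (density_ae hd) => x /= /[apply] ->.
  by rewrite -EFinB -EFinM.
have int1 : \int[Q]_x (cst 1) x = 1 by rewrite integral_cst// mul1e; exact: probability_setT.
have inth : \int[Q]_x (h x)%:E = 1 by rewrite -PE// probability_setT.
have mh2 : measurable_fun [set: T] (fun x => (h x ^+ 2)%:E).
  by apply/measurable_EFinP; exact: measurable_funX.
have mh12 : measurable_fun [set: T] (fun x => ((h x - 1) ^+ 2)%:E).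
  by apply/measurable_EFinP; apply: measurable_funX; exact: measurable_funB.
have mhE : measurable_fun [set: T] (fun x => (h x)%:E) by exact/measurable_EFinP.
have : \int[Q]_x (((h x - 1) ^+ 2)%:E + (2%:E * (h x)%:E)) =
       \int[Q]_x ((h x ^+ 2)%:E + cst 1 x).
  by apply: eq_integral => x _; rewrite /= -EFinM -!EFinD; congr (_%:E); ring.
rewrite ge0_integralD//; last 3 first.
- by move=> x _; rewrite lee_fin sqr_ge0.
- by move=> x _; rewrite mule_ge0// lee_fin.
- exact: measurable_funeM.
rewrite ge0_integralD//; last by move=> x _; rewrite lee_fin sqr_ge0.
rewrite ge0_integralZl//; last by move=> x _; rewrite lee_fin.
rewrite inth int1 mule1 => E.
have E1 : 1 + (\int[Q]_x ((h x - 1) ^+ 2)%:E + 1) = \int[Q]_x (h x ^+ 2)%:E + 1.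
  by rewrite -E addeCA -EFinD.
have /(congr1 (fun z => z - 1%E)) := E1.
by rewrite addeA !addeK.
Qed.

Section chi2_permutation_mixture.
Context d (T : measurableType d) (R : realType) (n : nat).
Variables (P : 'I_n.+1 -> probability T R) (h : 'I_n.+1 -> T -> R).
Hypothesis hd : forall i, is_density (P i) (average P) (h i).

Let Q := average P.
Let N := n.+1.
Let mh i : measurable_fun [set: T] (h i). Proof. by case: (hd i). Qed.
Let h0 i x : (0 <= h i x)%R. Proof. by case: (hd i). Qed.
Let mhh i j : measurable_fun [set: T] (fun x => h i x * h j x)%R.
Proof. exact: measurable_funM. Qed.
Let hh0 i j x : (0 <= h i x * h j x)%R. Proof. exact: mulr_ge0. Qed.

Lemma integral_average (g : T -> \bar R) :
  measurable_fun [set: T] g -> (forall x, 0 <= g x) ->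
  \int[average P]_x g x = (N%:R^-1)%:E * \sum_i \int[P i]_x g x.
Proof. by move=> mg g0; rewrite [LHS]integral_pmixture// card_ord. Qed.

Let int_h i : \int[Q]_x (h i x)%:E = 1.
Proof. by case: (hd i) => _ _ PE; rewrite -PE// probability_setT. Qed.

Let int_hh i j : \int[Q]_x (h i x * h j x)%:E = \int[P j]_x (h i x)%:E.
Proof.
rewrite (density_change_of_variables (hd j))//; last by move=> x; rewrite lee_fin.
exact/measurable_EFinP.
Qed.

(** The measure of density [h j] is [P j], and the [P j] add up to [N] times the
    average. This also shows that the products [h i * h j] are integrable. *)
Let sum_int_hh i : \sum_j \int[Q]_x (h i x * h j x)%:E = N%:R%:E.
Proof.
under eq_bigr => j _ do rewrite int_hh.
have := integral_average (proj2 (measurable_EFinP _ _) (mh i)) (fun x => h0 i x : 0 <= (h i x)%:E).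
rewrite [LHS](int_h i) => /(congr1 (fun z => N%:R%:E * z)).
by rewrite mule1 muleA -EFinM mulfV ?pnatr_eq0// mul1e => ->.
Qed.

Let int_hh_ge0 i j : 0 <= \int[Q]_x (h i x * h j x)%:E.
Proof. by apply: integral_ge0 => x _; rewrite lee_fin. Qed.

Let int_hh_fin i j : \int[Q]_x (h i x * h j x)%:E \is a fin_num.
Proof.
rewrite ge0_fin_numE// (@le_lt_trans _ _ N%:R%:E) ?ltry//.
rewrite -(sum_int_hh i) (bigD1 j)//= leeDl// sume_ge0//.
Qed.

Lemma channel_overlapE i j :
  (N%:R * channel_overlap P i j)%:E = \int[average P]_x (h i x * h j x)%:E.
Proof.
rewrite mxE mulrA mulfV ?pnatr_eq0// mul1r.
have -> : \int[average P]_x (density (P i) (average P) x * density (P j) (average P) x) =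
          \int[average P]_x (h i x * h j x)%:E.
  have md k : measurable_fun [set: T] (density (P k) (average P)).
    apply: (@measurable_int _ _ _ (average P)); apply: Radon_Nikodym_integrable.
    exact: density_dominates (hd k).
  apply: ae_eq_integral => //.
  - exact: emeasurable_funM.
  - exact/measurable_EFinP.
  apply: filterS2 (density_ae (hd i)) (density_ae (hd j)) => x /= di dj Dx.
  by rewrite di// dj// EFinM.
by rewrite fineK// int_hh_fin.
Qed.

Lemma channel_overlap_ge0 i j : (0 <= channel_overlap P i j)%R.
Proof.
have : (0 <= N%:R * channel_overlap P i j)%R.
  by rewrite -lee_fin channel_overlapE int_hh_ge0.
by rewrite pmulr_rge0// ltr0n.
Qed.

Lemma channel_overlap_sym : (channel_overlap P)^T = channel_overlap P.
Proof.
apply/matrixP => i j; rewrite mxE.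
have N0 : (N%:R != 0 :> R)%R by rewrite pnatr_eq0.
apply: (mulfI N0); apply: EFin_inj; rewrite !channel_overlapE.
by apply: eq_integral => x _; rewrite mulrC.
Qed.

Lemma channel_overlap_row i : (\sum_j channel_overlap P i j = 1)%R.
Proof.
have N0 : (N%:R != 0 :> R)%R by rewrite pnatr_eq0.
apply: (mulfI N0); apply: EFin_inj; rewrite mulr_sumr -sumEFin mulr1.
by under eq_bigr => j _ do rewrite channel_overlapE; rewrite sum_int_hh.
Qed.

Lemma channel_overlap_psd (v : 'rV[R]_n.+1) :
  (0 <= (v *m channel_overlap P *m v^T) 0 0)%R.
Proof.
have N0 : (0 < N%:R :> R)%R by rewrite ltr0n.
rewrite -(pmulr_rge0 _ N0) -lee_fin.
have hhint i j : (average P).-integrable [set: T] (fun x => (h i x * h j x)%:E).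
  apply/integrableP; split; first exact/measurable_EFinP.
  under eq_integral => x _ do rewrite gee0_abs ?lee_fin//.
  by rewrite -ge0_fin_numE// int_hh_fin.
have -> : (N%:R * (v *m channel_overlap P *m v^T) 0 0)%:E =
    \int[average P]_x ((\sum_i v 0 i * h i x) ^+ 2)%R%:E.
  rewrite mxE mulr_sumr -sumEFin.
  transitivity (\sum_(j < n.+1) \sum_(i < n.+1)
      \int[average P]_x ((v 0 i * v 0 j)%:E * (h i x * h j x)%:E)).
    apply: eq_bigr => j _; rewrite !mxE mulr_suml mulr_sumr -sumEFin.
    apply: eq_bigr => i _; rewrite integralZl// -channel_overlapE -EFinM.
    by congr (_%:E); ring.
  pose f i j x := (v 0 i * v 0 j)%:E * (h i x * h j x)%:E.
  have fint i j : (average P).-integrable [set: T] (f i j) by exact: integrableZl.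
  have E j : \sum_(i < n.+1) \int[average P]_x f i j x =
      \int[average P]_x \sum_(i < n.+1) f i j x by rewrite integral_sum.
  rewrite (eq_bigr _ (fun j _ => E j)) -integral_sum//; last first.
    by move=> j; exact: integrable_sum.
  apply: eq_integral => x _; rewrite expr2 big_distrlr/=.
  rewrite exchange_big/= -sumEFin; apply: eq_bigr => i _.
  rewrite -sumEFin; apply: eq_bigr => j _; rewrite /f -EFinM.
  by congr (_%:E); ring.
by apply: integral_ge0 => x _; rewrite lee_fin sqr_ge0.
Qed.

Let L (t : n.+1.-tuple T) : R :=
  (N`!%:R^-1 * \sum_(s : 'S_n.+1) \prod_i h (s i) (tnth t i))%R.

Let mprod (s : 'S_n.+1) : measurable_fun [set: n.+1.-tuple T]
  (fun t => (\prod_i h (s i) (tnth t i))%:E).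
Proof.
by apply/measurable_EFinP; exact: (@measurable_prod_tnth _ _ _ _ (fun i => h (s i))).
Qed.

Lemma permutation_mixture_density :
  is_density (permutation_mixture P) (iid_average P) L.
Proof.
split.
- apply: measurable_funM; first exact: measurable_cst.
  by apply: measurable_sum => s; apply/measurable_EFinP; exact: mprod.
- by move=> t; rewrite /L mulr_ge0 ?invr_ge0// sumr_ge0// => s _; rewrite prodr_ge0.
move=> A mA.
have m1 : measurable_fun [set: n.+1.-tuple T] (fun t => (\1_A t)%:E : \bar R).
  by apply/measurable_EFinP; exact: measurable_indic.
have i0 t : 0 <= (\1_A t)%:E :> \bar R by rewrite lee_fin.
have -> : permutation_mixture P A = \int[permutation_mixture P]_t (\1_A t)%:E.
  by rewrite integral_indic// setIT.
rewrite [LHS]integral_pmixture// card_Sn.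
under eq_bigr => s _ do
  rewrite (integral_product_prob_density (Q := average P) (h := fun i => h (s i)))//.
rewrite -ge0_integral_sum//; last 2 first.
- by move=> s; exact: emeasurable_funM.
- by move=> s t _; rewrite mule_ge0// lee_fin prodr_ge0.
rewrite -ge0_integralZl//; last 2 first.
- by apply: emeasurable_sum => s; exact: emeasurable_funM.
- by move=> t _; rewrite sume_ge0// => s _; rewrite mule_ge0// lee_fin prodr_ge0.
rewrite [RHS]integral_mkcond.
apply: eq_integral => t _; rewrite epatch_indic/=.
 rewrite -ge0_sume_distrr; last first.
  by move=> s _; rewrite lee_fin prodr_ge0.
by rewrite sumEFin muleCA -EFinM muleC.
Qed.

(** The square of the density is a double sum over permutations of products over
    the coordinates, which integrate to products of entries of the overlap matrix. *)
Lemma chi2_permutation_mixture :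
  1 + chi2 (permutation_mixture P) (iid_average P) =
  (N%:R ^+ N / N`!%:R ^+ 2 * \sum_(s : 'S_N) \sum_(t : 'S_N)
     \prod_(i < N) channel_overlap P (s i) (t i))%R%:E.
Proof.
rewrite (chi2_density permutation_mixture_density).
transitivity (\int[iid_average P]_t ((N`!%:R ^- 2)%:E *
   \sum_(s : 'S_N) \sum_(s' : 'S_N) (\prod_i (h (s i) (tnth t i) * h (s' i) (tnth t i)))%:E)).
  apply: eq_integral => t _.
  under eq_bigr => s _ do rewrite sumEFin.
  rewrite sumEFin -EFinM; congr (_%:E); rewrite /L exprMn exprVn; congr (_ * _)%R.
  rewrite expr2 big_distrlr/=; apply: eq_bigr => s _; apply: eq_bigr => s' _.
  by rewrite big_split.
have m2 (s s' : 'S_N) : measurable_fun [set: n.+1.-tuple T]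
    (fun t => (\prod_i (h (s i) (tnth t i) * h (s' i) (tnth t i)))%:E).
  apply/measurable_EFinP.
  exact: (@measurable_prod_tnth _ _ _ _ (fun i x => h (s i) x * h (s' i) x)%R).
have p0 (s s' : 'S_N) (t : n.+1.-tuple T) :
    0 <= (\prod_i (h (s i) (tnth t i) * h (s' i) (tnth t i)))%:E.
  by rewrite lee_fin prodr_ge0.
rewrite ge0_integralZl//; last 2 first.
- by apply: emeasurable_sum => s; apply: emeasurable_sum => s'.
- by move=> t _; rewrite sume_ge0// => s _; rewrite sume_ge0.
rewrite ge0_integral_sum//; last 2 first.
- by move=> s; apply: emeasurable_sum => s'.
- by move=> s t _; rewrite sume_ge0.
rewrite [(_ / _)%R]mulrC -mulrA EFinM; congr (_ * _).
rewrite mulr_sumr -sumEFin; apply: eq_bigr => s _.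
rewrite ge0_integral_sum// mulr_sumr -sumEFin; apply: eq_bigr => s' _.
rewrite [LHS](integral_product_prob_prod _ (u := fun i x => h (s i) x * h (s' i) x)%R)//.
under eq_bigr => i _ do rewrite -channel_overlapE.
rewrite prodEFin; congr (_%:E); rewrite big_split/= prodr_const card_ord.
by [].
Qed.

End chi2_permutation_mixture.

Local Close Scope ereal_scope.

(** * Repeating each distribution *)

Section cyclic_repetition.
Context {n : nat}.

(** The cardinality [(n + 1) (m + 1)] is written as [(m + n (m + 1)) + 1] because
    tuples of distributions are indexed by ordinals with an explicit successor. *)
Definition cyc m (x : 'I_(m + n * m.+1).+1) : 'I_n.+1 := inord (x %% n.+1).

Lemma sum_cyc (V : pzRingType) m (F : 'I_n.+1 -> V) :
  \sum_(x < (m + n * m.+1).+1) F (cyc x) = m.+1%:R * \sum_i F i.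
Proof.
pose G k := F (inord (k %% n.+1)).
rewrite -(big_mkord xpredT G).
have -> : (m + n * m.+1).+1 = (m.+1 * n.+1)%N by rewrite [RHS]mulnC mulSn.
have E : \sum_i F i = \sum_(0 <= k < n.+1) G k.
  by rewrite big_mkord; apply: eq_bigr => i _; rewrite /G modn_small// inord_val.
rewrite E mulr_natl; elim: m.+1 => [|k IH]; first by rewrite mul0n big_geq// mulr0n.
rewrite mulSnr (big_cat_nat (n := k * n.+1))//=; last exact: leq_addr.
rewrite IH mulrSr; congr (_ + _).
rewrite -{1}[(k * n.+1)%N]add0n big_addn addKn; apply: eq_bigr => i _.
by rewrite /G addnC modnMDl.
Qed.

End cyclic_repetition.

Section repetition.
Context d (T : measurableType d) (R : realType) (n : nat).
Variable P : 'I_n.+1 -> probability T R.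

Lemma average_dominates i : P i `<< average P.
Proof.
apply/null_content_dominatesP => A mA /eqP.
rewrite mule_eq0 eqe invr_eq0 card_ord pnatr_eq0/= => /eqP.
move=> sum0; apply/eqP; rewrite eq_le measure_ge0 andbT -sum0 (bigD1 i)//=.
by rewrite leeDl// sume_ge0.
Qed.

Lemma average_densities : exists h : 'I_n.+1 -> T -> R,
  forall i, is_density (P i) (average P) (h i).
Proof.
have /choice[h hd] i := dominates_is_density (average_dominates i).
by exists h.
Qed.

Let repeat m (x : 'I_(m + n * m.+1).+1) := P (cyc x).

Lemma average_repeat m (A : set T) : measurable A ->
  average (@repeat m) A = average P A.
Proof.
move=> mA; have fin i : P i A = (fine (P i A))%:E.
  by rewrite fineK// fin_num_measure.
rewrite [LHS]/(mixture _ _) [RHS]/(mixture _ _) /mixture !card_ord.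
under eq_bigr => x _ do rewrite fin.
under [in RHS]eq_bigr => x _ do rewrite fin.
rewrite !sumEFin -!EFinM (sum_cyc m (fun i => fine (P i A))); congr (_%:E).
have -> : (m + n * m.+1).+1 = (n.+1 * m.+1)%N by rewrite mulSn.
by rewrite natrM; field; rewrite !nat1r !pnatr_eq0.
Qed.

Lemma density_repeat m (h : 'I_n.+1 -> T -> R) :
  (forall i, is_density (P i) (average P) (h i)) ->
  forall x, is_density (@repeat m x) (average (@repeat m)) (h (cyc x)).
Proof.
move=> hd x; have [mh h0 PE] := hd (cyc x); split=> // A mA.
rewrite /repeat PE//; apply: eq_measure_integral => B mB _.
by apply/esym; exact: average_repeat.
Qed.

(** Repetition changes neither the average nor the densities, only the
    normalization of the overlap matrix. *)
Lemma channel_overlap_repeat m x y :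
  channel_overlap (@repeat m) x y =
  channel_overlap P (cyc x) (cyc y) * m.+1%:R^-1.
Proof.
have [h hd] := average_densities.
have := channel_overlapE (density_repeat (m := m) hd) x y.
have -> : (\int[average (@repeat m)]_z (h (cyc x) z * h (cyc y) z)%:E =
          \int[average P]_z (h (cyc x) z * h (cyc y) z)%:E)%E.
  by apply: eq_measure_integral => B mB _; exact: average_repeat.
rewrite -(channel_overlapE hd) => -[].
move: (channel_overlap (@repeat m) x y) => z.
have -> : (m + n * m.+1).+1 = (n.+1 * m.+1)%N by rewrite mulSn.
rewrite natrM -mulrA => /mulfI <-; last by rewrite pnatr_eq0.
by rewrite mulrAC mulfV ?mul1r// pnatr_eq0.
Qed.

End repetition.

(** * The lower bounds *)

Section lower_bound.
Context d (T : measurableType d) (R : realType).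
Variable PP : set (probability T R).

Lemma chi2_le_family n (P : 'I_n.+1 -> probability T R) : (forall i, PP (P i)) ->
  (1 + chi2 (permutation_mixture P) (iid_average P) <= 1 + chi2_family PP)%E.
Proof.
move=> PPP; apply: leeD2l.
apply: (@le_trans _ _ (ereal_sup [set chi2 (permutation_mixture P') (iid_average P') |
    P' in [set P' : 'I_n.+1 -> probability T R | forall i, PP (P' i)]])).
  by apply: ereal_sup_ubound; exists P.
by apply: ereal_sup_ubound; exists n.
Qed.

Variables (n : nat) (P : 'I_n.+1 -> probability T R).
Hypothesis PPP : forall i, PP (P i).
Variables (V : 'M[R]_n.+1) (e : 'rV[R]_n.+1) (C : R).
Hypotheses (VV : V *m V^T = 1%:M)
  (AE : channel_overlap P = V^T *m diag_mx e *m V)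
  (V0 : forall j, V 0 j = (Num.sqrt n.+1%:R)^-1) (e0 : e 0 0 = 1)
  (e01 : forall i, 0 <= e 0 i <= 1)
  (PPC : (1 + chi2_family PP = C%:E)%E).

Let v (r : 'I_n) i := Num.sqrt (e 0 (lift ord0 r)) * V (lift ord0 r) i.

Let orthV r q : \sum_i V r i * V q i = (r == q)%:R.
Proof.
move/matrixP: VV => /(_ r q); rewrite !mxE => <-.
by apply: eq_bigr => i _; rewrite mxE.
Qed.

Let v_sum r : \sum_i v r i = 0.
Proof.
have s0 : (Num.sqrt n.+1%:R)^-1 != 0 :> R by rewrite invr_eq0 sqrtr_eq0 -ltNge ltr0n.
apply: (mulfI s0); rewrite mulr0 mulr_sumr.
rewrite (eq_bigr (fun i => Num.sqrt (e 0 (lift ord0 r)) * (V 0 i * V (lift ord0 r) i))).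
  by rewrite -mulr_sumr orthV mulr0.
by move=> i _; rewrite V0 /v; ring.
Qed.

Let v_dot r q : \sum_i v r i * v q i = if r == q then e 0 (lift ord0 r) else 0.
Proof.
rewrite (eq_bigr (fun i => Num.sqrt (e 0 (lift ord0 r)) * Num.sqrt (e 0 (lift ord0 q)) *
    (V (lift ord0 r) i * V (lift ord0 q) i))); last by move=> i _; rewrite /v; ring.
rewrite -mulr_sumr orthV (inj_eq lift_inj); case: eqP => [<-|_]; last by rewrite mulr0.
by rewrite mulr1 -expr2 sqr_sqrtr//; have /andP[] := e01 (lift ord0 r).
Qed.

(** The overlap matrix of the repeated family is the Gram matrix of the scaled
    eigenvectors; the eigenvector of index 0 is constant, as [sum_perm2_gram_ge]
    requires. *)
Let repeated_lower_bound m L : (n * L <= (m + n * m.+1).+1)%N ->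
  \sum_(a : {ffun 'I_n -> 'I_L})
    (injsum finset.set0 [seq (fun y : 'I_(m + n * m.+1).+1 =>
        v r (cyc y) * Num.sqrt (m.+1%:R^-1)) | r <- word a]) ^+ 2
      / \prod_r ((a r)`!%:R) <= C.
Proof.
move=> nL; set M := (m + n * m.+1).+1 in nL *.
pose w (r : 'I_n.+1) (x : 'I_M) := Num.sqrt (e 0 r) * V r (cyc x) * Num.sqrt (m.+1%:R^-1).
pose c : R := (Num.sqrt n.+1%:R)^-1 * Num.sqrt (m.+1%:R^-1).
have w0 : w ord0 = fun=> c.
  by apply/funext => x; rewrite /w e0 V0 sqrtr1 mul1r.
have cM : c ^+ 2 * M%:R = 1.
  rewrite /c exprMn exprVn !sqr_sqrtr ?invr_ge0//.
  have -> : M = (n.+1 * m.+1)%N by rewrite mulSn.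
  by rewrite natrM; field; rewrite !nat1r !pnatr_eq0.
apply: le_trans (sum_perm2_gram_ge w0 cM nL) _.
have PP' (x : 'I_M) : PP (P (cyc x)) by exact: PPP.
rewrite -lee_fin -PPC; apply: le_trans (chi2_le_family PP').
have [h hd] := average_densities (fun x : 'I_M => P (cyc x)).
rewrite (chi2_permutation_mixture hd) lee_fin.
rewrite le_eqVlt; apply/orP; left; apply/eqP; congr (_ * _).
apply: eq_bigr => s _; apply: eq_bigr => t _; apply: eq_bigr => i _.
rewrite channel_overlap_repeat AE orthodiag_entry mulr_suml.
apply: eq_bigr => r _.
have er : Num.sqrt (e 0 r) ^+ 2 = e 0 r.
  by rewrite sqr_sqrtr//; have /andP[] := e01 r.
have em : Num.sqrt (m.+1%:R^-1) ^+ 2 = m.+1%:R^-1 :> R.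
  by rewrite sqr_sqrtr// invr_ge0.
by rewrite -er -em /w er; rewrite -[in RHS]er; ring.
Qed.

(** For a fixed truncation [L] there are finitely many types, so the number of
    copies can tend to infinity term by term; the limit factors over the
    eigenvectors by distributivity. *)
Lemma wick_series_le L :
  \prod_(r < n) \sum_(c < L) wick (e 0 (lift ord0 r)) c ^+ 2 / c`!%:R <= C.
Proof.
rewrite bigA_distr_bigA/=.
have cv : (\sum_(a : {ffun 'I_n -> 'I_L})
    (injsum finset.set0 [seq (fun y : 'I_(m + n * m.+1).+1 =>
        v r (cyc y) * Num.sqrt (m.+1%:R^-1)) | r <- word a]) ^+ 2
      / \prod_r ((a r)`!%:R)) @[m --> \oo] -->
  \sum_(a : {ffun 'I_n -> 'I_L})
    (\prod_r wick (e 0 (lift ord0 r)) (count_mem r (word a))) ^+ 2 / \prod_r ((a r)`!%:R).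
  apply: cvg_big => [|a _]; first exact: add_continuous.
  apply: cvgM; last exact: cvg_cst.
  apply: (@continuous_cvg _ _ _ _ _ _ (fun x : R => x ^+ 2)).
    exact: exprn_continuous.
  exact: (@injsum_word_cvg R _ _ (@cyc n) (@sum_cyc n R) _ v
    (fun r => e 0 (lift ord0 r)) (word a) v_sum v_dot).
rewrite (eq_bigr (fun a : {ffun 'I_n -> 'I_L} =>
    (\prod_r wick (e 0 (lift ord0 r)) (count_mem r (word a))) ^+ 2 / \prod_r ((a r)`!%:R))).
  rewrite -(cvg_lim (@Rhausdorff R) cv); apply: limr_le.
    by apply/cvg_ex; eexists; exact: cv.
  near=> m; apply: repeated_lower_bound.
  have Lm : (L <= m)%N by near: m; exact: nbhs_infty_ge.
  rewrite (leq_trans (leq_mul (leqnn n) (leq_trans Lm (leqnSn m))))//.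
  by rewrite (leq_trans (leq_addl m _))// leqnSn.
move=> a _; rewrite big_split/= prodfV -prodrXl; congr (_ / _).
by apply: eq_bigr => r _; rewrite count_word.
Unshelve. all: by end_near. Qed.

Lemma prod_eigen_le :
  [/\ 0 <= C, forall r : 'I_n, e 0 (lift ord0 r) < 1 &
    \prod_(r < n) (Num.sqrt (1 - e 0 (lift ord0 r) ^+ 2))^-1 <= C].
Proof. by apply: prod_inv_sqrt_le => [r|L]; [exact: e01|exact: wick_series_le]. Qed.

End lower_bound.

Section overlap_spectrum.
Context d (T : measurableType d) (R : realType) (n : nat).
Variable P : 'I_n.+1 -> probability T R.

Lemma channel_overlap_spectral :
  exists V : 'M[R]_n.+1, exists e : 'rV[R]_n.+1,
    [/\ V *m V^T = 1%:M, channel_overlap P = V^T *m diag_mx e *m V,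
        forall j, V 0 j = (Num.sqrt n.+1%:R)^-1, e 0 0 = 1 &
        forall i, 0 <= e 0 i <= 1].
Proof.
have [h hd] := average_densities P.
apply: stochastic_spectral.
- exact: (channel_overlap_sym hd).
- exact: (channel_overlap_ge0 hd).
- exact: (channel_overlap_row hd).
- exact: (channel_overlap_psd hd).
Qed.

Lemma eigenvalues_overlap (V : 'M[R]_n.+1) (e : 'rV[R]_n.+1) :
  V *m V^T = 1%:M -> channel_overlap P = V^T *m diag_mx e *m V ->
  e 0 0 = 1 -> (forall i, 0 <= e 0 i <= 1) ->
  [/\ char_poly (channel_overlap P) =
        \prod_(x <- eigenvalues (channel_overlap P)) ('X - x%:P),
      eigenvalues (channel_overlap P) = 1 :: behead (eigenvalues (channel_overlap P)) &
      perm_eq (behead (eigenvalues (channel_overlap P)))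
        [seq e 0 (lift ord0 r) | r <- enum 'I_n]].
Proof.
move=> VV AE e0 e01.
pose s := [seq e 0 (lift ord0 r) | r <- enum 'I_n].
have charE : char_poly (channel_overlap P) = \prod_(x <- 1 :: s) ('X - x%:P).
  by rewrite AE char_poly_orthodiag// big_ord_recl big_cons e0 big_map big_enum.
have [|hd bh] := eigenvalues_head charE.
  by move=> _ /mapP[r _ ->]; have /andP[] := e01 (lift ord0 r).
split=> //; rewrite charE; apply: perm_big.
by rewrite perm_sym; exact: perm_eigenvalues.
Qed.

End overlap_spectrum.

Lemma prod_inv_sqrt (R : rcfType) (I : Type) (s : seq I) (p : pred I) (x : I -> R) :
  (forall i, p i -> 0 <= x i) ->
  \prod_(i <- s | p i) (Num.sqrt (x i))^-1 = (Num.sqrt (\prod_(i <- s | p i) x i))^-1.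
Proof.
move=> x0; suff [] : 0 <= \prod_(i <- s | p i) x i /\
    (Num.sqrt (\prod_(i <- s | p i) x i))^-1 = \prod_(i <- s | p i) (Num.sqrt (x i))^-1 by [].
apply: (big_ind2 (fun a b => 0 <= a /\ (Num.sqrt a)^-1 = b)).
- by rewrite sqrtr1 invr1.
- by move=> a1 b1 a2 b2 [a1_ge0 <-] [a2_ge0 <-]; rewrite mulr_ge0// sqrtrM// invfM.
- by move=> i pi; rewrite x0.
Qed.

Local Open Scope ereal_scope.

Lemma prod_inve_sqrt (R : realType) (I : eqType) (s : seq I) (p : pred I) (x : I -> R) :
  (forall i, p i -> (0 < x i)%R) ->
  \prod_(i <- s | p i) (Num.sqrt (x i))%:E^-1 =
  (\prod_(i <- s | p i) (Num.sqrt (x i))^-1)%R%:E.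
Proof.
move=> x0; rewrite -prodEFin; apply: eq_bigr => i pi.
by rewrite inver gt_eqF// sqrtr_gt0 x0.
Qed.

Theorem theorem1p5 (R : realType) (d : measure_display) (T : measurableType d)
    (PP : set (probability T R)) :
  [/\ forall (n : nat) (P : 'I_n.+1 -> probability T R), (forall i, PP (P i)) ->
        let A := channel_overlap P in
        let lambda := eigenvalues A in
        [/\ char_poly A = (\prod_(x <- lambda) ('X - x%:P))%R,
            lambda`_0 = 1%R,
            sorted >=%R lambda &
            forall x, x \in lambda -> (0 <= x)%R],
      sup_tuples PP (fun n P =>
          let lambda := eigenvalues (channel_overlap P) in
          \prod_(1 <= i < n.+1) (Num.sqrt (1 - lambda`_i ^+ 2))%:E^-1)
        <= 1 + chi2_family PP &
      sup_tuples PP (fun n P =>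
          let A := channel_overlap P in
          (Num.sqrt n.+1%:R)%:E^-1 *
          \prod_(i < n.+1 | i != ord0) (Num.sqrt (1 - A i i ^+ 2))%:E^-1)
        <= 1 + chi2_family PP].
Proof.
(* a single tuple has a finite divergence, so the supremum is not -oo *)
have family_cases n (P : 'I_n.+1 -> probability T R) : (forall i, PP (P i)) ->
    1 + chi2_family PP = +oo \/ exists C, 1 + chi2_family PP = C%:E.
  move=> PPP; have := chi2_le_family PPP.
  have [h hd] := average_densities P; rewrite (chi2_permutation_mixture hd).
  by case: (1 + chi2_family PP) => [C _|_|//]; [right; exists C|left].
split.
- move=> n P PPP A lambda.
  have [V [e [VV AE _ e0 e01]]] := channel_overlap_spectral P.
  have [charE hd bh] := eigenvalues_overlap VV AE e0 e01.
  split=> //.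
  + by rewrite /lambda /A hd.
  + by apply: sort_sorted => x y; exact: le_total.
  move=> x; rewrite /lambda /A hd in_cons => /orP[/eqP ->//|].
  by rewrite (perm_mem bh) => /mapP[r _ ->]; have /andP[] := e01 (lift ord0 r).
- apply: ge_ereal_sup => _ [n _ <-]; apply: ge_ereal_sup => _ [P PPP <-].
  have [->|[C CE]] := family_cases n P PPP; first exact: leey.
  have [V [e [VV AE V0 e0 e01]]] := channel_overlap_spectral P.
  have [_ hd bh] := eigenvalues_overlap VV AE e0 e01.
  have [C0 e1 prodC] := prod_eigen_le PPP VV AE V0 e0 e01 CE.
  rewrite /= hd big_add1/=.
  set s := behead _ in bh *.
  have szs : size s = n by rewrite (perm_size bh) size_map size_enum_ord.
  rewrite -{1}szs -(big_nth 0%R xpredT (fun x => (Num.sqrt (1 - x ^+ 2))%:E^-1)).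
  rewrite (perm_big _ bh)/= big_map big_enum/= prod_inve_sqrt; last first.
    move=> r _; rewrite subr_gt0 exprn_ilt1//.
    by have /andP[] := e01 (lift ord0 r).
  by rewrite CE lee_fin.
apply: ge_ereal_sup => _ [n _ <-]; apply: ge_ereal_sup => _ [P PPP <-] /=.
have [->|[C CE]] := family_cases n P PPP; first exact: leey.
have [V [e [VV AE V0 e0 e01]]] := channel_overlap_spectral P.
have [C0 e1 prodC] := prod_eigen_le PPP VV AE V0 e0 e01 CE.
have [h hd] := average_densities P.
have Asym := channel_overlap_sym hd.
have Aii_ge0 i : (0 <= channel_overlap P i i)%R by exact: (channel_overlap_ge0 hd).
have Aii_le1 i : (channel_overlap P i i <= 1)%R.
  rewrite -(channel_overlap_row hd i) (bigD1 i)//= lerDl sumr_ge0// => j _.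
  exact: (channel_overlap_ge0 hd).
have diag_ge0 i : (0 <= 1 - channel_overlap P i i ^+ 2)%R.
  by rewrite subr_ge0 expr_le1.
have le_diag := prod_eigen_le_prod_diag Asym VV AE V0 e0 e01.
have eig_gt0 r : r != ord0 -> (0 < 1 - e 0 r ^+ 2)%R.
  rewrite eq_sym => /unlift_some[j -> _]; rewrite subr_gt0 exprn_ilt1//.
  by have /andP[] := e01 (lift ord0 j).
have prod_gt0 : (0 < \prod_(r < n.+1 | r != ord0) (1 - e 0 r ^+ 2))%R.
  by apply: prodr_gt0 => r; exact: eig_gt0.
(* a diagonal entry equal to 1 would annihilate the determinant bound *)
have diag_gt0 i : i != ord0 -> (0 < 1 - channel_overlap P i i ^+ 2)%R.
  move=> i0; rewrite lt_def diag_ge0 andbT; apply/negP => /eqP dgi.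
  have := lt_le_trans prod_gt0 le_diag.
  by rewrite (bigD1 i)//= dgi mul0r mulr0 ltxx.
rewrite prod_inve_sqrt// inver gt_eqF ?sqrtr_gt0 ?ltr0n// -EFinM CE lee_fin.
apply: le_trans prodC.
have -> : (\prod_(r < n) (Num.sqrt (1 - e 0 (lift ord0 r) ^+ 2))^-1 =
    (Num.sqrt (\prod_(r < n.+1 | r != ord0) (1 - e 0 r ^+ 2)))^-1)%R.
  rewrite -prod_inv_sqrt => [|r /eig_gt0/ltW//].
  by rewrite [RHS]big_mkcond big_ord_recl/= mul1r.
rewrite prod_inv_sqrt// -invfM -sqrtrM//.
have diag_prod_gt0 := lt_le_trans prod_gt0 le_diag.
by rewrite lef_pV2 ?posrE ?sqrtr_gt0 ?ler_sqrt// ltW.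
Qed.
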